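(* Let $z:\mathbb X\to[0,\infty)$ be measurable with $\lambda_z(B)=\int_Bz\,d\lambda<\infty$ for all $B\in\mathcal X_{\mathsf b}$, and let $v:\mathbb X\times\mathbb X\to\mathbb R\cup\{\infty\}$ be a measurable symmetric pair potential. Assume (i) $v(x,y)\ge0$ for $\lambda_z^2$-almost all $(x,y)\in\mathbb X^2$, and (ii) $\int_{\mathbb X}|f(x,y)|\,d\lambda_z(y)<\infty$ for $\lambda$-almost all $x\in\mathbb X$, where $f(x,y)=e^{-v(x,y)}-1$. Then $\mathscr G(z)\ne\varnothing$.
   Context: $(\mathbb X,\mathrm{dist})$ is a complete separable metric space with Borel $\sigma$-algebra $\mathcal X$, $\mathcal X_{\mathsf b}$ the bounded Borel sets, $\lambda$ a measure finite on bounded sets. $\mathcal N$ is the set of measures $\eta$ on $\mathbb X$ with $\eta(B)\in\mathbb N_0$ for $B\in\mathcal X_{\mathsf b}$, with $\sigma$-algebra $\mathfrak N$ generated by $\eta\mapsto\eta(B)$. $W(x;\eta)=\int v(x,y)\,d\eta(y)$. $\mathscr G(z)$ is the set of probability measures $\mathsf P$ on $(\mathcal N,\mathfrak N)$ satisfying $\mathsf E[\int_{\mathbb X}F(x,\eta)\,d\eta(x)]=\int_{\mathbb X}\mathsf E[F(x,\eta+\delta_x)e^{-W(x;\eta)}]z(x)\,d\lambda(x)$ for all measurable $F:\mathbb X\times\mathcal N\to[0,\infty)$. *)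

(* Defs.v *)
From HB Require Import structures.
From mathcomp Require Import all_boot all_order all_algebra.
From mathcomp Require Import all_classical all_reals all_analysis measurable_realfun.
Set Implicit Arguments.
Unset Strict Implicit.
Unset Printing Implicit Defensive.
Import Order.TTheory GRing.Theory Num.Theory.
Local Open Scope classical_set_scope.
Local Open Scope ring_scope.

Section metric.
Context {X : Type} {R : realType} (dist : X -> X -> R).

Definition is_metric : Prop :=
  [/\ forall x y, dist x y = 0 <-> x = y,
      forall x y, dist x y = dist y x &
      forall x y w, dist x w <= dist x y + dist y w].

Definition dist_cauchy (u : nat -> X) : Prop :=
  forall e : R, 0 < e -> exists N : nat, forall m n : nat,
    (N <= m)%N -> (N <= n)%N -> dist (u m) (u n) < e.

Definition dist_converges (u : nat -> X) (l : X) : Prop :=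
  forall e : R, 0 < e -> exists N : nat, forall n : nat,
    (N <= n)%N -> dist (u n) l < e.

Definition dist_complete : Prop :=
  forall u : nat -> X, dist_cauchy u -> exists l, dist_converges u l.

Definition dist_separable : Prop :=
  exists D : set X, countable D /\
    forall x (e : R), 0 < e -> exists y, D y /\ dist x y < e.

Definition dist_open (U : set X) : Prop :=
  forall x, U x -> exists2 e : R, 0 < e & forall y, dist x y < e -> U y.

Definition dist_bounded (B : set X) : Prop :=
  exists r : R, forall x y, B x -> B y -> dist x y <= r.

End metric.

Section counting_measures.
Context d (X : measurableType d) (R : realType) (dist : X -> X -> R).

Definition Xb (B : set X) : Prop := measurable B /\ dist_bounded dist B.

Record cmeasure := CMeasure {
  cm :> {measure set X -> \bar R} ;
  cm_int : forall B, Xb B -> exists n : nat, cm B = (n%:R)%:E }.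

Lemma mzero_int B : Xb B -> exists n : nat, (@mzero d X R) B = (n%:R)%:E.
Proof. by move=> _; exists 0%N. Qed.

Definition cm0 : cmeasure := @CMeasure mzero mzero_int.

HB.instance Definition _ := gen_eqMixin cmeasure.
HB.instance Definition _ := gen_choiceMixin cmeasure.
HB.instance Definition _ := isPointed.Build cmeasure cm0.

Definition cm_eval (B : set X) (eta : cmeasure) : \bar R := eta B.

Definition cm_measurable : set (set cmeasure) :=
  <<s \bigcup_(B in measurable) preimage_set_system [set: cmeasure] (cm_eval B)
        (@measurable _ (\bar R)) >>.

Let cm_measurable0 : cm_measurable set0.
Proof. exact: sigma_algebra0. Qed.

Let cm_measurableC (U : set cmeasure) :
  cm_measurable U -> cm_measurable (~` U).
Proof. exact: sigma_algebraC. Qed.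

Let cm_measurableU (F : (set cmeasure)^nat) :
  (forall i, cm_measurable (F i)) -> cm_measurable (\bigcup_i F i).
Proof. exact: sigma_algebra_bigcup. Qed.

Definition cm_display : measure_display.
Proof. by constructor. Qed.

HB.instance Definition _ :=
  @isMeasurable.Build cm_display cmeasure cm_measurable
    cm_measurable0 cm_measurableC cm_measurableU.

Lemma cm_add_dirac_int (eta : cmeasure) (x : X) B :
  Xb B -> exists n : nat, (measure_add eta (\d_x)) B = (n%:R)%:E.
Proof.
move=> hB; have [n hn] := cm_int eta hB.
rewrite /measure_add /msum big_ord_recr /= big_ord_recr /= big_ord0.
rewrite hn /dirac /indic.
exists (n + (x \in B))%N.
by rewrite add0e -EFinD natrD; case: (x \in B).
Qed.

Definition cm_add_dirac (eta : cmeasure) (x : X) : cmeasure :=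
  @CMeasure (measure_add eta (\d_x)) (@cm_add_dirac_int eta x).

End counting_measures.

Local Open Scope ereal_scope.

Definition Wpot d (X : measurableType d) (R : realType) (dist : X -> X -> R)
  (v : X -> X -> \bar R) (x : X) (eta : cmeasure dist) : \bar R :=
  \int[cm eta]_y v x y.

(** the set \mathscr G(z) of Gibbs measures (GNZ equation) *)
Definition Gibbs d (X : measurableType d) (R : realType) (dist : X -> X -> R)
  (lam : {measure set X -> \bar R}) (z : X -> R) (v : X -> X -> \bar R)
  : set (probability (cmeasure dist) R) :=
  [set P | forall F : X * cmeasure dist -> \bar R,
     measurable_fun [set: X * cmeasure dist] F -> (forall p, 0 <= F p) ->
     \int[P]_eta (\int[cm eta]_x F (x, eta)) =
     \int[lam]_x ((\int[P]_eta (F (x, cm_add_dirac eta x)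
                                  * expeR (- Wpot v x eta))) * (z x)%:E)].

Definition lam_z d (X : measurableType d) (R : realType)
  (lam : {measure set X -> \bar R}) (z : X -> R) : set X -> \bar R :=
  fun A => \int[lam]_(x in A) (z x)%:E.

Definition mayer {X : Type} {R : realType} (v : X -> X -> \bar R) (x y : X)
  : \bar R := expeR (- v x y) - 1.

(* Main.v *)
(** In a window of finite activity the grand canonical measure satisfies the GNZ
    equation, with weight exp (- W (x; eta)) in [0, 1] when v >= 0.  Since the weight
    is at most 1, the configuration inside a bounded set C is, jointly with the
    configuration in a disjoint set, dominated by exp (lambda_z (C)) times a Poisson
    process on C, uniformly in the window.  Hence along an ultrafilter the local
    marginals converge setwise, and the limits have densities with respect to
    products; the Ionescu-Tulcea argument then glues them into a probability on
    counting measures.  The GNZ equation survives because truncating the interaction of x to the window La_l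
    costs at most the integral of |f (x, y)| over y outside La_l, again by the
    domination.  A potential that is only almost everywhere nonnegative is replaced
    by its positive part: for almost every x, almost no configuration under the
    resulting Gibbs measure has a point y with v (x, y) < 0. *)
Require Import Defs.
From HB Require Import structures.
From mathcomp Require Import all_boot all_order all_algebra.
From mathcomp Require Import all_classical all_reals all_analysis measurable_realfun.
From mathcomp Require Import finmap ring lra.
Set Implicit Arguments.
Unset Strict Implicit.
Unset Printing Implicit Defensive.
Import Order.TTheory GRing.Theory Num.Theory.
Import numFieldNormedType.Exports HBNNSimple.
Local Open Scope classical_set_scope.
Local Open Scope ring_scope.
Local Open Scope ereal_scope.

(** * Measures, densities and setwise limits *)

(** The energy [W (x; eta)] depends on the whole configuration, so local convergence says nothing
    about it: the GNZ equation is tested with the interaction cut at [La l], the limit along the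
    ultrafilter is taken at fixed [l], and only then does [l] tend to infinity. The error of the cut
    must therefore be uniform in the window. A setwise limit along an ultrafilter need not be
    countably additive; a fixed finite dominating measure makes it so, and the Poisson bound
    provides one. The ultrafilter gives limits on all events at once, where a subsequence would call
    for a countable determining class. Regular conditional probabilities would require a standard
    Borel structure on configurations; densities with respect to the product of a marginal and a
    Poisson measure replace them. The constant exp (lambda_z (C)) is the total mass of the sum of
    the measures lambda_z^n / n! on C, kept unnormalised. *)

Section measures.
Context d (T : measurableType d) (R : realType).

Lemma le_measurable (m : {measure set T -> \bar R}) A B :
  measurable A -> measurable B -> A `<=` B -> m A <= m B.
Proof. by move=> mA mB AB; apply: le_measure => //; exact/mem_set. Qed.

Lemma measure_lty (m : {measure set T -> \bar R}) : m setT < +oo ->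
  forall A, measurable A -> m A < +oo.
Proof. by move=> mT A mA; apply: le_lt_trans mT; exact: le_measurable. Qed.

(** The standard machine: simple functions from indicators, then increasing limits. Relations
    between integrals that respect sums, scaling and monotone limits are reduced to events by it. *)
Lemma ge0_fun_ind (Pr : (T -> \bar R) -> Prop) :
  (forall A, measurable A -> Pr (fun x => (\1_A x)%:E)) ->
  (forall f g, measurable_fun setT f -> measurable_fun setT g ->
    (forall x, 0 <= f x) -> (forall x, 0 <= g x) ->
    Pr f -> Pr g -> Pr (f \+ g)) ->
  (forall (c : R) f, (0 <= c)%R -> measurable_fun setT f ->
    (forall x, 0 <= f x) -> Pr f -> Pr (fun x => c%:E * f x)) ->
  (forall f_ : (T -> \bar R)^nat, (forall n, measurable_fun setT (f_ n)) ->
    (forall n x, 0 <= f_ n x) ->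
    (forall x, {homo f_ ^~ x : m n / (m <= n)%N >-> m <= n}) ->
    (forall n, Pr (f_ n)) -> Pr (fun x => limn (f_ ^~ x))) ->
  forall f, measurable_fun setT f -> (forall x, 0 <= f x) -> Pr f.
Proof.
move=> P1 PD PZ Plim f mf f0.
have Psfun (h : {nnsfun T >-> R}) : Pr (fun x => (h x)%:E).
  have -> : (fun x => (h x)%:E) = (fun x =>
      \sum_(y <- (fset_set (range h) : seq R)) (y%:E * (\1_(h @^-1` [set y]) x)%:E)).
    apply/funext => x; rewrite fimfunE fsbig_finite//= -sumEFin.
    by apply: eq_bigr => y _; rewrite EFinM.
  have yge0 (y : R) : y \in (fset_set (range h) : seq R) -> (0 <= y)%R.
    by rewrite in_fset_set// => /set_mem[x _ <-].
  elim: (fset_set (range h) : seq R) (yge0) => [|y s ih] yge.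
    rewrite (_ : (fun _ => _) = fun x => (\1_set0 x)%:E); first exact: P1.
    by apply/funext => x; rewrite big_nil indic0.
  have y0 : (0 <= y)%R by apply: yge; rewrite mem_head.
  have m1 (A : set T) : measurable A -> measurable_fun setT (fun x => (\1_A x)%:E : \bar R).
    by move=> mA; apply/measurable_EFinP; exact: measurable_indic.
  have mh z : measurable (h @^-1` [set z]) by exact: measurable_sfunP.
  rewrite (_ : (fun _ => _) = (fun x => y%:E * (\1_(h @^-1` [set y]) x)%:E) \+
     (fun x => \sum_(z <- s) z%:E * (\1_(h @^-1` [set z]) x)%:E)); last first.
    by apply/funext => x; rewrite big_cons.
  have sge z : z \in s -> (0 <= z)%R.
    by move=> zs; apply: yge; rewrite inE zs orbT.
  apply: PD.
  - by apply: measurable_funeM; exact: m1.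
  - by apply: emeasurable_sum => z; apply: measurable_funeM; exact: m1.
  - by move=> x; rewrite mule_ge0// lee_fin.
  - move=> x; rewrite big_seq; apply: sume_ge0 => z zs.
    by rewrite mule_ge0// lee_fin sge.
  - by apply: PZ; [exact: y0|exact: m1|move=> x; rewrite lee_fin|exact: P1].
  - exact: ih.
pose g := nnsfun_approx measurableT mf.
rewrite (_ : f = fun x => limn (fun n => (g n x)%:E)); last first.
  apply/funext => x; apply/esym/cvg_lim => //.
  by apply: cvg_nnsfun_approx => // y _; exact: f0.
apply: (Plim (fun n x => (g n x)%:E)) => //.
- by move=> n; apply/measurable_EFinP.
- by move=> n x; rewrite lee_fin.
- move=> x m n mn; rewrite lee_fin.
  by have /lefP := nd_nnsfun_approx measurableT mf mn; exact.
Qed.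

Section density.
Variables (mu : {measure set T -> \bar R}) (g : T -> \bar R).
Hypotheses (mg : measurable_fun setT g) (g0 : forall x, 0 <= g x).
Hypothesis gfin : forall x, g x \is a fin_num.

Definition density (A : set T) : \bar R := \int[mu]_(x in A) g x.

Let density0 : density set0 = 0. Proof. exact: integral_set0. Qed.

Let density_ge0 A : 0 <= density A. Proof. exact: integral_ge0. Qed.

Let density_sigma : semi_sigma_additive density.
Proof.
move=> F mF tF mUF; rewrite [X in _ --> X]ge0_integral_bigcup//; last first.
  exact: measurable_funTS.
by apply: is_cvg_nneseries => n _ _; exact: integral_ge0.
Qed.

Definition density_measure : {measure set T -> \bar R} :=
  HB.pack_for (measure T R) density
    (isMeasure.Build d T R density density0 density_ge0 density_sigma).

Lemma integral_density f : measurable_fun setT f -> (forall x, 0 <= f x) ->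
  \int[density_measure]_x f x = \int[mu]_x (f x * g x).
Proof.
move=> mf f0.
pose Pr f := \int[density_measure]_x f x = \int[mu]_x (f x * g x).
suff: Pr f by [].
apply: ge0_fun_ind mf f0 => //; rewrite /Pr.
- move=> A mA; rewrite integral_indic// setIT /= /density.
  rewrite [LHS]integral_mkcond; apply: eq_integral => x _.
  by rewrite patchE indicE; case: ifPn => xA; rewrite ?mul1e ?mul0e.
- move=> h k mh mk h0 k0 ih ik; rewrite ge0_integralD// ih ik -ge0_integralD//.
  + by apply: eq_integral => x _; rewrite ge0_muleDl.
  + by move=> x _; exact: mule_ge0.
  + exact: emeasurable_funM.
  + by move=> x _; exact: mule_ge0.
  + exact: emeasurable_funM.
- move=> c h c0 mh h0 ih; rewrite ge0_integralZl// ih -ge0_integralZl//.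
  + by apply: eq_integral => x _; rewrite muleA.
  + exact: emeasurable_funM.
  + by move=> x _; exact: mule_ge0.
- move=> h mh h0 ndh ih.
  rewrite monotone_convergence//.
  transitivity (limn (fun n => \int[mu]_x (h n x * g x))).
    by congr (limn _); apply/funext => n; rewrite ih.
  rewrite -monotone_convergence//.
  + apply: eq_integral => x _.
    by rewrite limeMr//; apply: ereal_nondecreasing_is_cvgn; exact: ndh.
  + by move=> n; exact: emeasurable_funM.
  + by move=> n x _; exact: mule_ge0.
  + by move=> x _ m n mn; rewrite lee_wpmul2r// ndh.
Qed.

End density.

Lemma integral_restr (m : {measure set T -> \bar R}) (D : set T) (mD : measurable D) f :
  measurable_fun setT f -> (forall x, 0 <= f x) ->
  \int[mrestr m mD]_x f x = \int[m]_(x in D) f x.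
Proof.
move=> mf f0; rewrite [RHS]integral_mkcond.
have m1 : measurable_fun setT (fun x => (\1_D x)%:E : \bar R).
  by apply/measurable_EFinP; exact: measurable_indic.
have i0 x : 0 <= (\1_D x)%:E :> \bar R by rewrite lee_fin.
transitivity (\int[density_measure m m1 i0]_x f x).
  apply: eq_measure_integral => A mA _.
  by rewrite /= /density integral_indic// setIC.
rewrite integral_density//.
by apply: eq_integral => x _; rewrite patchE indicE; case: ifPn; rewrite ?mule1 ?mule0.
Qed.

Section finite.
Variable m : {measure set T -> \bar R}.
Hypothesis mfin : m setT < +oo.

Let fm : set T -> \bar R := m.
HB.instance Definition _ := Measure.on fm.
HB.instance Definition _ := @Measure_isFinite.Build d T R fm (lty_fin_num_fun mfin).
Definition finite_of : {finite_measure set T -> \bar R} := fm.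

End finite.
End measures.

(** GNZ is linear in the process, so the scalar [c] is exposed to carry it over to the normalised
    measure. In finite volume the lower bound on the mass comes from the empty configuration. *)
Lemma normalize_measure d (T : measurableType d) (R : realType)
    (m : {measure set T -> \bar R}) : m setT < +oo -> 1 <= m setT ->
  exists (P : probability T R) (c : R), (0 <= c)%R /\
    (forall A, measurable A -> P A = c%:E * m A) /\
    forall f, measurable_fun setT f -> (forall x, 0 <= f x) ->
    \int[P]_x f x = c%:E * \int[m]_x f x.
Proof.
move=> mfin m1; pose c := (fine (m setT))^-1%R.
have mE : m setT = (fine (m setT))%:E by rewrite fineK// ge0_fin_numE.
have gt0 : (0 < fine (m setT))%R.
  by rewrite -lte_fin -mE (lt_le_trans _ m1)// lte_fin.
have c0 : (0 <= c)%R by rewrite invr_ge0 ltW.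
pose p := mscale (NngNum c0) m.
have p1 : p setT = 1 by rewrite /p/mscale/= mE -EFinM /c mulVf// gt_eqF.
pose P : probability T R := HB.pack_for (probability T R) p
  (@Measure_isProbability.Build d T R p p1).
exists P, c; split => //; split => // f mf f0.
by rewrite -(@ge0_integral_mscale _ _ _ m setT measurableT (NngNum c0)).
Qed.

Section image_measure.
Context d d' (T : measurableType d) (T' : measurableType d') (R : realType).
Variables (m : {measure set T -> \bar R}) (f : T -> T').
Hypothesis mf : measurable_fun setT f.

Let mpre A : measurable A -> measurable (f @^-1` A).
Proof. by move=> mA; rewrite -[X in measurable X]setTI; exact: mf. Qed.

Let image0 : m (f @^-1` set0) = 0. Proof. by rewrite preimage_set0 measure0. Qed.

Let image_ge0 A : 0 <= m (f @^-1` A). Proof. exact: measure_ge0. Qed.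

Let image_sigma : semi_sigma_additive (fun A => m (f @^-1` A)).
Proof.
move=> F mF tF mUF; rewrite preimage_bigcup.
apply: measure_semi_sigma_additive.
- by move=> n; exact: mpre.
- by apply/trivIsetP => i j _ _ ij; rewrite -preimage_setI; move/trivIsetP : tF => ->.
- by rewrite -preimage_bigcup; exact: mpre.
Qed.

Definition image_measure : {measure set T' -> \bar R} :=
  HB.pack_for (measure T' R) (fun A => m (f @^-1` A))
    (isMeasure.Build d' T' R _ image0 image_ge0 image_sigma).

Lemma integral_image h : measurable_fun setT h -> (forall x, 0 <= h x) ->
  \int[image_measure]_y h y = \int[m]_x h (f x).
Proof.
move=> mh h0; rewrite -(@ge0_integral_pushforward _ _ _ _ R f mf m setT h)//.
Qed.

End image_measure.

(** A disintegration by Radon-Nikodym: [h (x, .)] acts as the conditional density of the second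
    coordinate given [x]. As [p] is the first marginal of [Q], its [nu]-integral is 1 for [p]-almost
    every [x]. *)
Lemma kernel_density d1 d2 (T1 : measurableType d1) (T2 : measurableType d2)
    (R : realType) (p : {finite_measure set T1 -> \bar R})
    (nu : {finite_measure set T2 -> \bar R}) (Q : {measure set (T1 * T2) -> \bar R}) :
  (forall A, measurable A -> Q A <= (p \x nu) A) ->
  (forall A, measurable A -> Q (A `*` setT) = p A) ->
  exists h : T1 * T2 -> \bar R,
  [/\ measurable_fun setT h, forall q, 0 <= h q, forall q, h q \is a fin_num,
    forall x, \int[nu]_y h (x, y) <= 1 &
    forall f, measurable_fun setT f -> (forall q, 0 <= f q) ->
    \int[Q]_q f q = \int[p]_x \int[nu]_y (f (x, y) * h (x, y))].
Proof.
move=> Qle Qp.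
have Qfin : Q setT < +oo.
  rewrite -setXTT Qp//; move: (fin_num_measure p _ measurableT).
  by rewrite ge0_fin_numE.
pose fQ := finite_of Qfin.
have pnfin : (p \x nu) setT < +oo.
  rewrite -setXTT product_measure1E// -ge0_fin_numE ?mule_ge0//.
  by apply: fin_numM; [exact: (fin_num_measure p)|exact: (fin_num_measure nu)].
pose pn := finite_of pnfin.
have dom : fQ `<< pn.
  apply/null_content_dominatesP => A mA A0; apply/eqP; rewrite eq_le measure_ge0 andbT.
  by rewrite -A0 Qle.
pose g := Radon_Nikodym_SigmaFinite.f fQ pn.
have g0 q : 0 <= g q by exact: Radon_Nikodym_SigmaFinite.f_ge0.
have gfin q : g q \is a fin_num by exact: Radon_Nikodym_SigmaFinite.f_fin_num.
have mg : measurable_fun setT g.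
  by have /measurable_int := Radon_Nikodym_SigmaFinite.f_integrable dom.
have intQ f : measurable_fun setT f -> (forall q, 0 <= f q) ->
    \int[Q]_q f q = \int[p]_x \int[nu]_y (f (x, y) * g (x, y)).
  move=> mf f0; rewrite -[LHS](@Radon_Nikodym_SigmaFinite.change_of_variables _ _ _ fQ _ dom)//.
  rewrite -(@fubini_tonelli1 _ _ _ _ _ p nu (fun q => f q * g q))//.
    exact: emeasurable_funM.
  by move=> q; exact: mule_ge0.
pose G x := \int[nu]_y g (x, y).
have mG : measurable_fun setT G.
  exact: (@measurable_fun_fubini_tonelli_F _ _ _ _ R nu _ mg).
have G1 : ae_eq p setT (cst 1) G.
  have int1 : p.-integrable setT (cst (1%R)%:E).
    exact: finite_measure_integrable_cst.
  apply: integral_ae_eq => //.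
  move=> E _ mE; rewrite integral_cst// mul1e -Qp//.
  have mET : measurable (E `*` (@setT T2)) by exact: measurableX.
  have -> : Q (E `*` setT) = \int[Q]_q (\1_(E `*` (@setT T2)) q)%:E.
    by rewrite integral_indic// setIT.
  have mi : measurable_fun setT (fun q => (\1_(E `*` (@setT T2)) q)%:E : \bar R).
    by apply/measurable_EFinP; exact: measurable_indic.
  have i0 q : 0 <= (\1_(E `*` (@setT T2)) q)%:E :> \bar R by rewrite lee_fin.
  rewrite (intQ _ mi i0).
  rewrite [RHS]integral_mkcond; apply: eq_integral => x _.
  rewrite patchE; case: ifPn => xE.
    by apply: eq_integral => y _; rewrite indicE mem_set ?mul1e//=; split => //; exact/set_mem.
  apply: integral0_eq => y _; rewrite indicE memNset ?mul0e//= => -[/= /mem_set].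
  by rewrite (negbTE xE).
(* The density is set to 0 over the [p]-null set of [x] where its integral exceeds 1, so that the
   bound holds for every [x]. *)
pose S := [set x | G x <= 1].
have mS : measurable S.
  by rewrite -[S]setTI; exact: measurable_lee.
pose h q := (\1_S q.1)%:E * g q.
have m1S : measurable_fun setT (fun q : T1 * T2 => (\1_S q.1)%:E : \bar R).
  by apply/measurable_EFinP; apply: measurableT_comp => //; exact: measurable_indic.
have mh : measurable_fun setT h by exact: emeasurable_funM.
have h0 q : 0 <= h q by rewrite mule_ge0// lee_fin.
exists h; split => //.
- by move=> q; rewrite fin_numM.
- move=> x; rewrite /h/= indicE; case: (boolP (_ \in _)) => [/set_mem xS|_].
    by under eq_integral do rewrite mul1e.
  by rewrite integral0_eq ?lee01// => y _; rewrite mul0e.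
- move=> f mf f0; rewrite (intQ f mf f0); apply: ge0_ae_eq_integral; first exact: measurableT.
  + apply: (@measurable_fun_fubini_tonelli_F _ _ _ _ R nu (fun q => f q * g q)).
      exact: emeasurable_funM.
    by move=> q; rewrite mule_ge0.
  + apply: (@measurable_fun_fubini_tonelli_F _ _ _ _ R nu (fun q => f q * h q)).
      exact: emeasurable_funM.
    by move=> q; rewrite mule_ge0.
  + by move=> x _; apply: integral_ge0 => y _; rewrite mule_ge0.
  + by move=> x _; apply: integral_ge0 => y _; rewrite mule_ge0.
  + move: G1; apply: filterS => x /(_ I) Gx _; apply: eq_integral => y _.
    by rewrite /h/= indicE mem_set ?mul1e// /S/= -Gx.
Qed.

Section content.
Context d (T : algebraOfSetsType d) (R : realType) (f : set T -> \bar R).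
Hypothesis f_ge0 : forall A, 0 <= f A.
Hypothesis fD : forall A B, measurable A -> measurable B -> [disjoint A & B] ->
  f (A `|` B) = f A + f B.
Hypothesis f_fin : f setT < +oo.
Hypothesis f_cvg0 : forall A : (set T)^nat, (forall n, measurable (A n)) ->
  (forall m n, (m <= n)%N -> A n `<=` A m) -> \bigcap_n A n = set0 ->
  f (A n) @[n --> \oo] --> 0.

Lemma content_fin A : measurable A -> f A \is a fin_num.
Proof.
move=> mA; rewrite ge0_fin_numE//; apply: le_lt_trans f_fin.
rewrite -(setUv A) fD//; first by rewrite leeDl.
  exact: measurableC.
by apply/disj_setPS; rewrite setICr.
Qed.

Lemma content0 : f set0 = 0.
Proof.
have := @fD set0 set0 measurable0 measurable0; rewrite setU0.
have -> : [disjoint (@set0 T) & set0] by apply/disj_setPS; rewrite set0I.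
move=> /(_ isT) E; move: E (content_fin measurable0); case: (f set0) => // r [].
by move=> /eqP; rewrite -subr_eq subrr => /eqP <-.
Qed.

(** [A n], the part of the union missed by the first [n] sets, decreases to the empty set, so
    continuity there makes the partial sums converge. *)
Lemma content_sigma_additive : semi_sigma_additive f.
Proof.
move=> F mF tF mUF.
have mS n : measurable (\big[setU/set0]_(i < n) F i) by exact: bigsetU_measurable.
pose A n := \bigcup_k F k `\` \big[setU/set0]_(i < n) F i.
have mA n : measurable (A n) by exact: measurableD.
have SE n : \sum_(0 <= i < n) f (F i) = f (\big[setU/set0]_(i < n) F i).
  elim: n => [|n ih]; first by rewrite big_nil big_ord0 content0.
  rewrite big_nat_recr//= ih big_ord_recr/= fD//; first exact: mS.
  apply/disj_setPS => x [].
  rewrite -bigcup_mkord => -[k /= kn Fkx] Fnx.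
  by have := tF k n I I; case/(_ (ex_intro _ x (conj Fkx Fnx)))/esym; move/eqP; rewrite gtn_eqF.
have UE n : \sum_(0 <= i < n) f (F i) = f (\bigcup_k F k) - f (A n).
  rewrite SE; have -> : f (\bigcup_k F k) = f (\big[setU/set0]_(i < n) F i) + f (A n).
    rewrite -fD//; last by apply/disj_setPS; rewrite setDIK.
    congr f; apply/esym/setDUK; rewrite -bigcup_mkord => x [k _ Fkx].
    by exists k.
  by rewrite addeK// content_fin.
rewrite (_ : (fun n => _) = fun n => f (\bigcup_k F k) - f (A n)); last first.
  by apply/funext => n; exact: UE.
rewrite -[X in _ --> X]sube0; apply: cvgeB => //.
- by rewrite fin_num_adde_defl// content_fin.
- exact: cvg_cst.
- apply: f_cvg0 => //.
  + move=> m n mn x [UFx nx]; split => //; apply: contra_not nx.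
    by apply: subset_bigsetU.
  + apply/seteqP; split => // x Ax.
    have [k _ Fkx] := (Ax 0%N I).1.
    have := (Ax k.+1 I).2; apply; rewrite -bigcup_mkord; exists k => //=.
Qed.

End content.

Section ultralimit.
Context (R : realType) (U : set_system nat) {UU : UltraFilter U}.

(** On the compact interval [0, c] the image ultrafilter has a cluster point, and an ultrafilter
    converges to its cluster points. *)
Lemma ultra_cvg (x : nat -> \bar R) (c : R) :
  (forall n, 0 <= x n <= c%:E) -> cvg (x @ U).
Proof.
move=> xc.
have xfin n : x n \is a fin_num.
  have /andP[x0 xlec] := xc n.
  by rewrite ge0_fin_numE// (le_lt_trans xlec)// ltry.
pose y n := fine (x n).
have xE : x = EFin \o y by apply/funext => n; rewrite /y/= fineK.
have yU : (y @ U) `[0%R, c]%classic.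
  rewrite /fmap/=; apply: filterS (filterT) => n _ /=; rewrite in_itv/=.
  by have := xc n; rewrite xE /= !lee_fin.
have [p [_ pc]] := @segment_compact R 0%R c _ _ yU.
have yp : y @ U --> p.
  move=> V Vp; have [//|nV] := in_ultra_setVsetC (y @^-1` V) UU.
  by have [z [/= nVz Vz]] := pc (~` V) V nV Vp.
by apply/cvg_ex; exists p%:E; rewrite xE; apply: cvg_EFin => //; apply: filterS filterT.
Qed.

End ultralimit.

Section limit_measure.
Context d (T : measurableType d) (R : realType) (U : set_system nat).
Context {UU : UltraFilter U}.
Variables (m_ : nat -> {measure set T -> \bar R}) (M : {measure set T -> \bar R}).
Hypothesis Mfin : M setT < +oo.
Hypothesis m_M : forall n A, measurable A -> m_ n A <= M A.

Let cvgm A : measurable A -> cvg (m_ n A @[n --> U]).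
Proof.
move=> mA; apply: (@ultra_cvg _ _ _ _ (fine (M A))) => n.
rewrite measure_ge0/= fineK ?m_M// ge0_fin_numE//.
exact: measure_lty Mfin _ _.
Qed.

(** Finite additivity passes to the limit. Countable additivity comes from [M]: along events
    decreasing to the empty set the limit is squeezed between 0 and the finite measure [M]. *)
Lemma limit_measure : exists m : {measure set T -> \bar R},
  forall A, measurable A -> m_ n A @[n --> U] --> m A.
Proof.
(* The value 0 off the measurable sets keeps [m] nonnegative on all sets. *)
pose m A := if `[< measurable A >] then lim (m_ n A @[n --> U]) else 0.
have mE A : measurable A -> m A = lim (m_ n A @[n --> U]) by rewrite /m => /asboolP ->.
have m0 A : 0 <= m A.
  rewrite /m; case: ifPn => // /asboolP mA.
  by apply: lime_ge; [exact: cvgm|exact: nearW].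
have mM A : measurable A -> m A <= M A.
  by move=> mA; rewrite mE//; apply: lime_le; [exact: cvgm|apply: nearW => n; exact: m_M].
have Mfn A : measurable A -> M A \is a fin_num.
  move=> mA; rewrite ge0_fin_numE//.
  exact: measure_lty Mfin _ _.
have mfn A : measurable A -> m A \is a fin_num.
  move=> mA; rewrite ge0_fin_numE// (le_lt_trans (mM _ mA))//.
  by rewrite -ge0_fin_numE// Mfn.
have mD A B : measurable A -> measurable B -> [disjoint A & B] ->
    m (A `|` B) = m A + m B.
  move=> mA mB AB; rewrite !mE//; last exact: measurableU.
  rewrite -limeD//; [|exact: cvgm|exact: cvgm|].
    have -> // : (fun n => m_ n (A `|` B)) = (fun n => m_ n A + m_ n B).
    by apply/funext => n; rewrite measureU//; exact/disj_set2P.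
  by rewrite -!mE// fin_num_adde_defl// mfn.
have mcvg0 (A : (set T)^nat) : (forall n, measurable (A n)) ->
    (forall m n, (m <= n)%N -> A n `<=` A m) -> \bigcap_n A n = set0 ->
    m (A n) @[n --> \oo] --> 0.
  move=> mA ndA A0.
  apply: (@squeeze_cvge _ _ _ _ (cst 0) _ (M \o A)); last 2 first.
  - exact: cvg_cst.
  - rewrite -(@measure0 _ _ _ M) -A0; apply: nonincreasing_cvg_mu => //.
    + exact: measure_lty Mfin _ _.
    + exact: bigcapT_measurable.
    + by move=> a b ab; apply/subsetPset; exact: ndA.
  - by apply: nearW => n; rewrite m0 mM.
have mTfin : m setT < +oo by rewrite (le_lt_trans (mM _ measurableT)).
pose mm : {measure set T -> \bar R} := HB.pack_for (measure T R) m
  (isMeasure.Build d T R m (content0 m0 mD mTfin) m0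
    (content_sigma_additive m0 mD mTfin mcvg0)).
by exists mm => A mA; rewrite /= mE//; exact: cvgm.
Qed.

End limit_measure.

Section limit_integral.
Context d (T : measurableType d) (R : realType) (U : set_system nat).
Context {UU : UltraFilter U}.
Variables (m_ : nat -> {measure set T -> \bar R}) (m : {measure set T -> \bar R}).
Variable c : R.
Hypothesis m_c : forall n, m_ n setT <= c%:E.
Hypothesis m_cvg : forall A, measurable A -> m_ n A @[n --> U] --> m A.

Let c0 : (0 <= c)%R.
Proof. by rewrite -lee_fin; apply: le_trans (m_c 0%N). Qed.

Let mT : m setT <= c%:E.
Proof.
rewrite -(cvg_lim _ (m_cvg measurableT))//; apply: lime_le.
  by apply/cvg_ex; exists (m setT); exact: m_cvg.
exact: nearW.
Qed.

Let cvg_nnsfun (h : {nnsfun T >-> R}) :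
  \int[m_ n]_x (h x)%:E @[n --> U] --> \int[m]_x (h x)%:E.
Proof.
have E (mu : {measure set T -> \bar R}) : \int[mu]_x (h x)%:E =
    \sum_(y <- (fset_set (range h) : seq R)) (y%:E * mu (h @^-1` [set y])).
  by rewrite integralT_nnsfun sintegralE fsbig_finite.
rewrite E (_ : (fun n => _) = (fun n =>
    \sum_(y <- (fset_set (range h) : seq R)) (y%:E * m_ n (h @^-1` [set y])))); last first.
  by apply/funext => n; exact: E.
have fin (mu : {measure set T -> \bar R}) (y : R) : mu setT <= c%:E ->
    y%:E * mu (h @^-1` [set y]) \is a fin_num.
  move=> muc; rewrite fin_numM// ge0_fin_numE//; apply: measure_lty => //.
  by rewrite (le_lt_trans muc)// ltry.
elim: (fset_set (range h) : seq R) => [|y s ih].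
  rewrite big_nil (_ : (fun n => _) = fun=> 0); first exact: cvg_cst.
  by apply/funext => n; rewrite big_nil.
rewrite big_cons (_ : (fun n => _) = (fun n => y%:E * m_ n (h @^-1` [set y]) +
    \sum_(y <- s) y%:E * m_ n (h @^-1` [set y]))); last first.
  by apply/funext => n; rewrite big_cons.
apply: cvgeD => //; first by rewrite fin_num_adde_defr// fin.
by apply: cvgeZl => //; exact: m_cvg.
Qed.

Lemma integral_bounded (mu : {measure set T -> \bar R}) (f : T -> \bar R) (b : R) :
  mu setT <= c%:E -> measurable_fun setT f -> (forall x, 0 <= f x <= b%:E) ->
  0 <= \int[mu]_x f x <= (b * c)%:E.
Proof.
move=> muT mf fb; rewrite integral_ge0/=; last by move=> x _; have /andP[] := fb x.
have b0 : (0 <= b)%R by have /andP[h1 h2] := fb point; rewrite -lee_fin (le_trans h1).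
apply: (@le_trans _ _ (\int[mu]_x b%:E)).
  apply: ge0_le_integral => //.
  - by move=> x _; have /andP[] := fb x.
  - by move=> x _; have /andP[] := fb x.
by rewrite integral_cst// EFinM lee_wpmul2l.
Qed.

Let lim_ge f b : measurable_fun setT f -> (forall x, 0 <= f x <= b%:E) ->
  \int[m]_x f x <= lim (\int[m_ n]_x f x @[n --> U]).
Proof.
move=> mf fb; have f0 x : 0 <= f x by have /andP[] := fb x.
have cf : cvg (\int[m_ n]_x f x @[n --> U]).
  by apply: (@ultra_cvg _ _ _ _ (b * c)) => n; exact: integral_bounded.
pose g := nnsfun_approx measurableT mf.
have fg x : f x = limn (fun n => (g n x)%:E).
  apply/esym/cvg_lim => //.
  by apply: cvg_nnsfun_approx => // y _; exact: f0.
under eq_integral do rewrite fg.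
rewrite monotone_convergence//; last 3 first.
- by move=> n; exact/measurable_EFinP.
- by move=> n x _; rewrite lee_fin.
- move=> x _ i j ij; rewrite lee_fin.
  by have /lefP := nd_nnsfun_approx measurableT mf ij; exact.
apply: lime_le.
  apply: ereal_nondecreasing_is_cvgn => i j ij; apply: ge0_le_integral => //.
  - by move=> x _; rewrite lee_fin.
  - exact/measurable_EFinP.
  - exact/measurable_EFinP.
  - move=> x _; rewrite lee_fin.
    by have /lefP := nd_nnsfun_approx measurableT mf ij; exact.
apply: nearW => k; rewrite -(cvg_lim _ (@cvg_nnsfun (g k)))//.
apply: lee_lim => //; first by apply/cvg_ex; eexists; exact: cvg_nnsfun.
apply: nearW => n; apply: ge0_le_integral => //.
- by move=> x _; rewrite lee_fin.
- exact/measurable_EFinP.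
- move=> x _; rewrite fg; apply: lime_ge.
    apply: ereal_nondecreasing_is_cvgn => i j ij; rewrite lee_fin.
    by have /lefP := nd_nnsfun_approx measurableT mf ij; exact.
  exists k => // j /= kj; rewrite lee_fin.
  by have /lefP := nd_nnsfun_approx measurableT mf kj; exact.
Qed.

(** [lim_ge] is a Fatou inequality, from simple functions below [f]. It is applied to [f] and to
    [b - f], whose integrals add up to [b] times a converging mass; this leaves no room for a strict
    inequality. *)
Lemma cvg_integral f b : measurable_fun setT f -> (forall x, 0 <= f x <= b%:E) ->
  \int[m_ n]_x f x @[n --> U] --> \int[m]_x f x.
Proof.
move=> mf fb; have f0 x : 0 <= f x by have /andP[] := fb x.
have b0 : (0 <= b)%R by have /andP[h1 h2] := fb point; rewrite -lee_fin (le_trans h1).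
have ffin x : f x \is a fin_num.
  by have /andP[? ?] := fb x; rewrite ge0_fin_numE// (le_lt_trans _ (ltry b)).
pose g x := b%:E - f x.
have mg : measurable_fun setT g by exact: emeasurable_funB.
have gb x : 0 <= g x <= b%:E.
  have /andP[f0x fbx] := fb x.
  by rewrite /g sube_ge0 ?ffin// fbx/= leeBlDr ?ffin// leeDl.
have g0 x : 0 <= g x by have /andP[] := gb x.
have cf : cvg (\int[m_ n]_x f x @[n --> U]).
  by apply: (@ultra_cvg _ _ _ _ (b * c)) => n; exact: integral_bounded.
have cg : cvg (\int[m_ n]_x g x @[n --> U]).
  by apply: (@ultra_cvg _ _ _ _ (b * c)) => n; exact: integral_bounded.
have Lfin h : measurable_fun setT h -> (forall x, 0 <= h x <= b%:E) ->
    lim (\int[m_ n]_x h x @[n --> U]) \is a fin_num.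
  move=> mh hb; have ch : cvg (\int[m_ n]_x h x @[n --> U]).
    by apply: (@ultra_cvg _ _ _ _ (b * c)) => n; exact: integral_bounded.
  rewrite ge0_fin_numE; last first.
    apply: lime_ge => //; apply: nearW => n.
    by have /andP[] := integral_bounded (m_c n) mh hb.
  rewrite (@le_lt_trans _ _ (b * c)%:E) ?ltry//; apply: lime_le => //.
  apply: nearW => n.
  by have /andP[] := integral_bounded (m_c n) mh hb.
have fgE (mu : {measure set T -> \bar R}) :
    \int[mu]_x f x + \int[mu]_x g x = b%:E * mu setT.
  rewrite -ge0_integralD// -integral_cst//.
  by apply: eq_integral => x _; rewrite /g/= addeC subeK.
have fgl : lim (\int[m_ n]_x f x @[n --> U]) + lim (\int[m_ n]_x g x @[n --> U])
    = \int[m]_x f x + \int[m]_x g x.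
  rewrite -limeD//; last by rewrite fin_num_adde_defl// Lfin.
  under eq_fun do rewrite fgE.
  rewrite fgE; apply/cvg_lim => //; apply: cvgeZl => //; exact: m_cvg.
have l1 := lim_ge mf fb.
have l2 := lim_ge mg gb.
apply: cvg_toP => //; apply/eqP; rewrite eq_le l1 andbT.
rewrite -(leeD2rE _ _ (Lfin _ mg gb)) fgl leeD2l//.
Qed.

End limit_integral.

(** * Counting measures and finite-volume Gibbs measures *)

Section counting_measures.
Context d (X : measurableType d) (R : realType) (dist : X -> X -> R).
Notation N := (cmeasure dist).

Lemma measurable_eval (B : set X) : measurable B ->
  measurable_fun setT (fun eta : N => eta B).
Proof.
move=> mB _ Y mY; rewrite setTI.
apply: sub_sigma_algebra; exists B => //.
by exists Y => //; rewrite setTI.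
Qed.

Lemma measurable_to_cm d' (T : measurableType d') (f : T -> N) :
  (forall B, measurable B -> measurable_fun setT (fun t => f t B)) ->
  measurable_fun setT f.
Proof.
move=> mf; apply: (measurability (\bigcup_(B in measurable)
   preimage_set_system [set: N] (cm_eval B) (@measurable _ (\bar R)))).
  by [].
move=> _ [_ [B mB [Y mY <-]] <-].
rewrite !setTI; have := mf B mB measurableT Y mY; rewrite setTI.
by apply.
Qed.

(* Leibniz equality of [cmeasure]s is too strong: the values on non-measurable sets are
   irrelevant for every measurable event. *)
Definition eqm (eta xi : N) := forall B, measurable B -> eta B = xi B.

(** Events that cannot tell [eqm] configurations apart form a sigma-algebra, and the generating
    events are among them. *)
Lemma eqm_measurable (A : set N) eta xi : measurable A -> eqm eta xi ->
  A eta -> A xi.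
Proof.
move=> mA e; suff: A eta <-> A xi by move=> [].
move: A mA; apply: smallest_sub; first split => //.
- by move=> A h; split=> -[_ h1]; split => // h2; apply: h1; apply/h.
- by move=> F h; split => -[i _ Fi]; exists i => //; apply/h.
- by move=> _ [B mB [Y mY <-]]; rewrite /= /cm_eval e.
Qed.

Lemma eqm_measurable_fun (f : N -> \bar R) eta xi : measurable_fun setT f ->
  eqm eta xi -> f eta = f xi.
Proof.
move=> mf e.
have mA : measurable (f @^-1` [set f eta]).
  by rewrite -[X in measurable X]setTI; apply: mf => //; exact: emeasurable_set1.
by have /= -> := eqm_measurable mA e erefl.
Qed.

Lemma measurable_comp2 d' (T : measurableType d') (F : X * N -> \bar R)
    (a : T -> X) (g : T -> N) : measurable_fun setT F ->
  measurable_fun setT a -> measurable_fun setT g ->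
  measurable_fun setT (fun t => F (a t, g t)).
Proof. by move=> mF ma mg; exact: (measurableT_comp mF (measurable_fun_pair ma mg)). Qed.

Lemma eqm_measurable_fun2 (F : X * N -> \bar R) x eta xi : measurable_fun setT F ->
  eqm eta xi -> F (x, eta) = F (x, xi).
Proof.
move=> mF; apply: (@eqm_measurable_fun (fun e => F (x, e))).
exact: measurable_fun_pair2.
Qed.

Section restr.
Variables (D : set X) (mD : measurable D).

Lemma cm_restr_int (eta : N) B : Xb dist B -> exists n : nat, mrestr eta mD B = n%:R%:E.
Proof.
move=> [mB [r rB]]; apply: (cm_int eta); split; first exact: measurableI.
by exists r => x y [Bx _] [By _]; exact: rB.
Qed.

Definition cm_restr (eta : N) : N := CMeasure (cm_restr_int eta).

Lemma cm_restrE eta B : cm_restr eta B = eta (B `&` D).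
Proof. by []. Qed.

Lemma measurable_cm_restr : measurable_fun setT cm_restr.
Proof. by apply: measurable_to_cm => B mB; apply: measurable_eval; exact: measurableI. Qed.

Lemma integral_cm_restr eta f : measurable_fun setT f -> (forall x, 0 <= f x) ->
  \int[cm (cm_restr eta)]_x f x = \int[cm eta]_(x in D) f x.
Proof. by move=> mf f0; exact: integral_restr. Qed.

End restr.

Section add.
Variables eta xi : N.

Lemma cm_add_int B : Xb dist B -> exists n : nat, measure_add eta xi B = n%:R%:E.
Proof.
move=> hB; have [n nE] := cm_int eta hB; have [m mE] := cm_int xi hB.
by exists (n + m)%N; rewrite measure_addE nE mE -EFinD natrD.
Qed.

Definition cm_add : N := CMeasure cm_add_int.

Lemma cm_addE B : cm_add B = eta B + xi B. Proof. exact: measure_addE. Qed.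

End add.

Lemma measurable_cm_add : measurable_fun setT (fun p : N * N => cm_add p.1 p.2).
Proof.
apply: measurable_to_cm => B mB.
under eq_fun do rewrite cm_addE.
apply: emeasurable_funD; [apply: (@measurableT_comp _ _ _ _ _ _ (fun eta : N => eta B))|
  apply: (@measurableT_comp _ _ _ _ _ _ (fun eta : N => eta B))] => //; exact: measurable_eval.
Qed.

Lemma cm_add_diracE (eta : N) x B : cm_add_dirac eta x B = eta B + \d_x B.
Proof. exact: measure_addE. Qed.

Lemma measurable_cm_add_dirac :
  measurable_fun setT (fun p : X * N => cm_add_dirac p.2 p.1).
Proof.
apply: measurable_to_cm => B mB.
under eq_fun do rewrite cm_add_diracE.
apply: emeasurable_funD.
  apply: (@measurableT_comp _ _ _ _ _ _ (fun eta : N => eta B)) => //; exact: measurable_eval.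
apply: (@measurableT_comp _ _ _ _ _ _ (fun x => \d_x B)) => //.
by apply/measurable_EFinP; exact: measurable_indic.
Qed.

Lemma measurable_add_dirac_comp d' (T : measurableType d') (a : T -> X) (g : T -> N) :
  measurable_fun setT a -> measurable_fun setT g ->
  measurable_fun setT (fun t => cm_add_dirac (g t) (a t)).
Proof.
by move=> ma mg; exact: (measurableT_comp measurable_cm_add_dirac (measurable_fun_pair ma mg)).
Qed.

Lemma integral_cm_add_dirac (eta : N) x f :
  measurable_fun setT f -> (forall y, 0 <= f y) ->
  \int[cm (cm_add_dirac eta x)]_y f y = \int[cm eta]_y f y + f x.
Proof.
by move=> mf f0; rewrite ge0_integral_measure_add// integral_dirac// diracT mul1e.
Qed.

Lemma integral_cm0 f : \int[cm (cm0 dist)]_y f y = 0.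
Proof. exact: integral_measure_zero. Qed.

(** * Bounded exhaustions and integrals against configurations *)

Section exhaustion.
Variable La : nat -> set X.
Hypothesis La_b : forall k, Xb dist (La k).
Hypothesis La_nd : forall i j, (i <= j)%N -> La i `<=` La j.
Hypothesis La_cover : \bigcup_k La k = setT.

(** For an indicator, [g t] is cut to [La k], where its mass is finite, so that the measurability of
    sections applies; then [k] tends to infinity. *)
Lemma measurable_integral_cm d' (T : measurableType d') (g : T -> N) (F : T * X -> \bar R) :
  measurable_fun setT g -> measurable_fun setT F -> (forall p, 0 <= F p) ->
  measurable_fun setT (fun t => \int[cm (g t)]_y F (t, y)).
Proof.
move=> mg; move: F.
apply: (@ge0_fun_ind _ _ R (fun F => measurable_fun setT (fun t => \int[cm (g t)]_y F (t, y)))).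
- move=> E mE.
  have mg' B : measurable B -> measurable_fun setT (fun t => g t B).
    move=> mB; apply: (@measurableT_comp _ _ _ _ _ _ (fun eta : N => eta B)) => //.
    exact: measurable_eval.
  pose K : R.-ker T ~> X := HB.pack_for (kernel T X R) (fun t => cm (g t))
    (@isKernel.Build _ _ T X R (fun t => cm (g t)) mg').
  pose h k t := g t (xsection E t `&` La k).
  have mLa k : measurable (La k) by have [] := La_b k.
  have mh k : measurable_fun setT (h k).
    have [] := @measurable_prod_subset_xsection_kernel _ _ T X R K (La k) (mLa k) _ E mE => //.
    move=> t; have [n nE] := cm_int (g t) (La_b k).
    (* The bound has to be strict, hence the added 1. *)
    exists (n%:R + 1)%R => Y mY; rewrite /mrestr.
    apply: (@le_lt_trans _ _ n%:R%:E).
      by rewrite -nE; apply: le_measurable => //; exact: measurableI.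
    by rewrite lte_fin ltrDl.
  have hE t : \int[cm (g t)]_y (\1_E (t, y))%:E = limn (fun k => h k t).
    transitivity (\int[cm (g t)]_y (\1_(xsection E t) y)%:E).
      by apply: eq_integral => y _; rewrite !indicE mem_xsection.
    rewrite integral_indic//; last exact: measurable_xsection.
    rewrite setIT -[X in cm _ X]setIT -La_cover setI_bigcupr.
    apply/esym/cvg_lim => //; apply: nondecreasing_cvg_mu.
    + by move=> k; apply: measurableI => //; exact: measurable_xsection.
    + by apply: bigcupT_measurable => k; apply: measurableI => //; exact: measurable_xsection.
    + by move=> i j ij; apply/subsetPset; apply: setIS; exact: La_nd.
  under eq_fun do rewrite hE.
  apply: (emeasurable_fun_cvg h) => // t _.
  apply: ereal_nondecreasing_is_cvgn => i j ij; apply: le_measurable => //.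
  + by apply: measurableI => //; exact: measurable_xsection.
  + by apply: measurableI => //; exact: measurable_xsection.
  + by apply: setIS; exact: La_nd.
- move=> f h mf mh f0 h0 If Ih.
  rewrite (_ : (fun t => _) = (fun t => \int[cm (g t)]_y f (t, y) + \int[cm (g t)]_y h (t, y))).
    exact: emeasurable_funD.
  by apply/funext => t; rewrite ge0_integralD//; exact: measurable_fun_pair2.
- move=> c f c0 mf f0 If.
  rewrite (_ : (fun t => _) = (fun t => c%:E * \int[cm (g t)]_y f (t, y))).
    exact: measurable_funeM.
  by apply/funext => t; rewrite ge0_integralZl//; exact: measurable_fun_pair2.
- move=> f mf f0 ndf If.
  rewrite (_ : (fun t => _) = (fun t => limn (fun k => \int[cm (g t)]_y f k (t, y)))).
    apply: (emeasurable_fun_cvg (fun k t => \int[cm (g t)]_y f k (t, y))) => // t _.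
    apply: ereal_nondecreasing_is_cvgn => i j ij; apply: ge0_le_integral => //.
    + exact: measurable_fun_pair2.
    + exact: measurable_fun_pair2.
    + by move=> y _; exact: ndf.
  apply/funext => t; rewrite -monotone_convergence//.
  by move=> k; exact: measurable_fun_pair2.
Qed.

(* [w (x, eta)] is the Boltzmann factor of adding the point [x] to [eta]; [w_sym] says
   that the factor of adding two points does not depend on their order. *)
Section finite_volume.
Variables (L : {finite_measure set X -> \bar R}) (w : X * N -> \bar R).
Hypothesis mw : measurable_fun setT w.
Hypothesis w01 : forall p, 0 <= w p <= 1.
Hypothesis w_sym : forall x y eta,
  w (x, cm_add_dirac eta y) * w (y, eta) = w (y, cm_add_dirac eta x) * w (x, eta).

Let w0 p : 0 <= w p. Proof. by have /andP[] := w01 p. Qed.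
Let w1 p : w p <= 1. Proof. by have /andP[] := w01 p. Qed.
Let wfin p : w p \is a fin_num.
Proof. by rewrite ge0_fin_numE// (le_lt_trans (w1 p))// ltry. Qed.

Definition fv_map (p : X * N) : N := cm_add_dirac p.2 p.1.

Lemma measurable_fv_map : measurable_fun setT fv_map.
Proof. exact: measurable_cm_add_dirac. Qed.

Section step.
Variables (m : {finite_measure set N -> \bar R}) (n : nat).

Let img := image_measure (@density_measure _ _ R (L \x m) w mw w0) measurable_fv_map.

Let n0 : (0 <= n.+1%:R^-1 :> R)%R. Proof. by []. Qed.

Definition fv_image : {measure set N -> \bar R} :=
  [the {measure set N -> \bar R} of mscale (NngNum n0) img].

Lemma integral_fv_image f : measurable_fun setT f -> (forall eta, 0 <= f eta) ->
  \int[fv_image]_eta f eta =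
  (n.+1%:R^-1)%:E * \int[L]_x \int[m]_eta (f (cm_add_dirac eta x) * w (x, eta)).
Proof.
move=> mf f0; rewrite ge0_integral_mscale//; congr (_ * _).
have mfa : measurable_fun setT (f \o fv_map).
  exact: (measurableT_comp mf measurable_fv_map).
rewrite integral_image// integral_density// fubini_tonelli1//.
- by move: (fin_num_measure L _ measurableT); rewrite ge0_fin_numE.
- exact: emeasurable_funM.
- by move=> p; rewrite mule_ge0.
Qed.

Lemma fv_image_fin : fv_image setT <= (n.+1%:R^-1)%:E * (L setT * m setT).
Proof.
rewrite /fv_image/= /mscale/= lee_wpmul2l ?lee_fin// preimage_setT /density.
rewrite -product_measure1E// -setXTT.
rewrite -[leRHS]mul1e -integral_cst//; last by rewrite setXTT.
rewrite setXTT; exact: ge0_le_integral.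
Qed.

Lemma fv_image_lty : fv_image setT < +oo.
Proof.
rewrite (le_lt_trans fv_image_fin)// -ge0_fin_numE.
  by rewrite !fin_numM// fin_num_measure.
by rewrite mule_ge0 ?lee_fin// mule_ge0.
Qed.

End step.

(* The [n]-point part [1/n! e^(-H) dL^n] of the grand canonical measure, obtained by
   adding one point at a time. *)
Fixpoint fv (n : nat) : {finite_measure set N -> \bar R} :=
  if n is k.+1 then finite_of (fv_image_lty (fv k) k)
  else [the {finite_measure set N -> \bar R} of \d_(cm0 dist)].

Arguments fv : simpl never.

Lemma integral_fv0 f : measurable_fun setT f -> \int[fv 0]_eta f eta = f (cm0 dist).
Proof. by move=> mf; rewrite integral_dirac// diracT mul1e. Qed.

Lemma integral_fvS n f : measurable_fun setT f -> (forall eta, 0 <= f eta) ->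
  \int[fv n.+1]_eta f eta =
  (n.+1%:R^-1)%:E * \int[L]_x \int[fv n]_eta (f (cm_add_dirac eta x) * w (x, eta)).
Proof. by move=> mf f0; rewrite -integral_fv_image. Qed.

(** Weights at most 1 leave at most the mass L(X)^n / n! of the case without interaction; the sum
    over [n] bounds the partition function by exp (L(X)). *)
Lemma fv_le n : fv n setT <= (exp_coeff (fine (L setT)) n)%:E.
Proof.
have Lf : L setT = (fine (L setT))%:E by rewrite fineK// fin_num_measure.
elim: n => [|n ih]; first by rewrite /= diracT exp_coeffE/= expr0 fact0 invr1 mulr1.
apply: (le_trans (fv_image_fin (fv n) n)).
rewrite {1}Lf exp_coeffE/= factS natrM invfM exprS.
apply: (@le_trans _ _ ((n.+1%:R^-1)%:E * ((fine (L setT))%:E * (exp_coeff (fine (L setT)) n)%:E))).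
  by rewrite lee_wpmul2l ?lee_fin// lee_wpmul2l// -Lf.
rewrite -!EFinM exp_coeffE/= lee_fin -subr_ge0 (_ : (_ - _)%R = 0%R)//; ring.
Qed.

Definition fvG : {measure set N -> \bar R} :=
  [the {measure set N -> \bar R} of mseries fv 0].

Lemma fvG_lty : fvG setT < +oo.
Proof.
rewrite /fvG/= /mseries.
apply: (@le_lt_trans _ _ (\sum_(n <oo) (exp_coeff (fine (L setT)) n)%:E)).
  by apply: lee_nneseries => // n _; exact: fv_le.
rewrite (_ : limn _ = (limn (series (exp_coeff (fine (L setT)))))%:E) ?ltry//.
rewrite -EFin_lim; last exact: is_cvg_series_exp_coeff.
by congr (limn _); apply/funext => n /=; rewrite sumEFin.
Qed.

Lemma fvG_ge1 : 1 <= fvG setT.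
Proof.
rewrite /fvG/= /mseries nneseries_recl//= diracT.
by rewrite leeDl// nneseries_ge0.
Qed.

Lemma integral_fvG f : measurable_fun setT f -> (forall eta, 0 <= f eta) ->
  \int[fvG]_eta f eta = \sum_(n <oo) \int[fv n]_eta f eta.
Proof. by move=> mf f0; rewrite ge0_integral_measure_series. Qed.

Let J n (F : X * N -> \bar R) :=
  \int[L]_x \int[fv n]_eta (F (x, cm_add_dirac eta x) * w (x, eta)).

Let A n (F : X * N -> \bar R) := \int[fv n]_eta \int[cm eta]_x F (x, eta).

Lemma measurable_integral_id (F : X * N -> \bar R) : measurable_fun setT F ->
  (forall p, 0 <= F p) -> measurable_fun setT (fun eta => \int[cm eta]_x F (x, eta)).
Proof.
move=> mF F0; apply: (@measurable_integral_cm _ N id (fun p => F (p.2, p.1))) => //.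
exact: measurable_comp2.
Qed.

Let Ay (F : X * N -> \bar R) y := fun p : X * N =>
  F (p.1, cm_add_dirac p.2 y) * w (y, p.2).

Let mFa (F : X * N -> \bar R) : measurable_fun setT F ->
  measurable_fun setT (fun p : X * N => F (p.1, cm_add_dirac p.2 p.1) * w p).
Proof.
move=> mF; apply: emeasurable_funM => //.
by apply: measurable_comp2 => //; exact: measurable_add_dirac_comp.
Qed.

Let mAy F y : measurable_fun setT F -> measurable_fun setT (Ay F y).
Proof.
move=> mF; apply: emeasurable_funM.
  by apply: measurable_comp2 => //; exact: measurable_add_dirac_comp.
by apply: measurable_comp2.
Qed.

(** The marked point is either the one added last, which gives [J n F], or an earlier one; then the
    last point [y] is absorbed into the test function [Ay F y]. *)
Let AS n F : measurable_fun setT F -> (forall p, 0 <= F p) ->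
  A n.+1 F = (n.+1%:R^-1)%:E * (\int[L]_y A n (Ay F y) + J n F).
Proof.
move=> mF F0; rewrite /A integral_fvS//; last 2 first.
- exact: measurable_integral_id.
- by move=> eta; exact: integral_ge0.
congr (_ * _).
pose B (p : X * N) := \int[cm p.2]_x Ay F p.1 (x, p.2).
have mB : measurable_fun setT B.
  apply: (@measurable_integral_cm _ (X * N)%type snd
    (fun q => Ay F q.1.1 (q.2, q.1.2))) => //.
    rewrite /Ay/=; apply: emeasurable_funM.
      apply: measurable_comp2 => //; apply: measurable_add_dirac_comp.
        exact: (measurableT_comp measurable_fst measurable_fst).
      exact: (measurableT_comp measurable_snd measurable_fst).
    apply: measurable_comp2 => //.
      exact: (measurableT_comp measurable_fst measurable_fst).
    exact: (measurableT_comp measurable_snd measurable_fst).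
  by move=> q; rewrite mule_ge0.
have B0 p : 0 <= B p by apply: integral_ge0 => x _; rewrite mule_ge0.
rewrite /J -ge0_integralD//; last 4 first.
- by move=> y _; apply: integral_ge0 => eta _; exact: (B0 (y, eta)).
- exact: measurable_fun_fubini_tonelli_F mB B0.
- by move=> y _; apply: integral_ge0 => eta _; rewrite mule_ge0.
- apply: (@measurable_fun_fubini_tonelli_F _ _ _ _ R (fv n) _ (mFa mF)).
  by move=> p; rewrite mule_ge0.
apply: eq_integral => y _.
rewrite -ge0_integralD//; last 4 first.
- by move=> eta _; exact: (B0 (y, eta)).
- exact: measurable_fun_pair2 mB.
- by move=> eta _; rewrite mule_ge0.
- exact: measurable_fun_pair2 (mFa mF).
apply: eq_integral => eta _.
rewrite integral_cm_add_dirac//; last exact: measurable_fun_pair1.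
rewrite ge0_muleDl//; last exact: integral_ge0.
congr (_ + _); rewrite /Ay/= muleC -ge0_integralZl//.
- by apply: eq_integral => x _; rewrite muleC.
- exact: measurable_fun_pair1.
Qed.

(** By induction, marking an earlier point becomes inserting [x] before the last point [y]. Thanks
    to [w_sym] the two can be exchanged, so that [y] integrates out and n+1 copies of [J n.+1 F]
    appear. With the case of the last point there are n+2 copies, cancelled by the factor
    1/(n+2). *)
Lemma fv_gnz n F : measurable_fun setT F -> (forall p, 0 <= F p) ->
  \int[fv n.+1]_eta \int[cm eta]_x F (x, eta) =
  \int[L]_x \int[fv n]_eta (F (x, cm_add_dirac eta x) * w (x, eta)).
Proof.
elim: n F => [|n ih] F mF F0; rewrite -[LHS]/(A _ F) -[RHS]/(J _ F) AS//.
  rewrite invr1 mul1e [X in X + _]integral0_eq ?add0e// => y _.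
  rewrite /A integral_fv0 ?integral_cm0//; apply: measurable_integral_id.
    exact: mAy.
  by move=> p; rewrite mule_ge0.
have -> : \int[L]_y A n.+1 (Ay F y) = n.+1%:R%:E * J n.+1 F.
  pose Phi (q : (X * X) * N) :=
    F (q.1.1, cm_add_dirac (cm_add_dirac q.2 q.1.2) q.1.1) *
    w (q.1.1, cm_add_dirac q.2 q.1.2) * w (q.1.2, q.2).
  have m1 : measurable_fun setT (fun q : (X * X) * N => q.1.1).
    exact: (measurableT_comp measurable_fst measurable_fst).
  have m2 : measurable_fun setT (fun q : (X * X) * N => q.1.2).
    exact: (measurableT_comp measurable_snd measurable_fst).
  have mPhi : measurable_fun setT Phi.
    apply: emeasurable_funM; last exact: measurable_comp2.
    apply: emeasurable_funM; apply: measurable_comp2 => //;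
      do ?apply: measurable_add_dirac_comp => //.
  have Phi0 q : 0 <= Phi q by rewrite !mule_ge0.
  have mPhiF := @measurable_fun_fubini_tonelli_F _ _ _ _ R (fv n) _ mPhi Phi0.
  have PhiF0 p : 0 <= fubini_F (fv n) Phi p by exact: integral_ge0.
  transitivity (\int[L]_y \int[L]_x fubini_F (fv n) Phi (x, y)).
    apply: eq_integral => y _.
    transitivity (J n (Ay F y)).
      by apply: ih; [exact: mAy|move=> p; rewrite mule_ge0].
    apply: eq_integral => x _; apply: eq_integral => eta _.
    rewrite /Phi/Ay/= -muleA w_sym muleA; congr (_ * _ * _).
    apply: eqm_measurable_fun2 => // B mB.
    by rewrite !cm_add_diracE -addeA (addeC (\d_x _)) addeA.
  rewrite -fubini_tonelli//; last first.
  rewrite /J -ge0_integralZl//; last 2 first.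
  - apply: (@measurable_fun_fubini_tonelli_F _ _ _ _ R (fv n.+1) _ (mFa mF)).
    by move=> p; rewrite mule_ge0.
  - by move=> x _; apply: integral_ge0 => eta _; rewrite mule_ge0.
  apply: eq_integral => x _.
  rewrite integral_fvS//; last 2 first.
  - exact: measurable_fun_pair2 (mFa mF).
  - by move=> eta; rewrite mule_ge0.
  by rewrite muleA -EFinM divff// mul1e.
rewrite -[X in _ * X + _]/(J n.+1 F).
rewrite -[X in _ + X]mul1e -ge0_muleDl ?lee_fin//.
by rewrite muleA -EFinD -EFinM -[X in (_ + X)%R]/(1%:R)%R -natrD addn1 mulVf// mul1e.
Qed.

Lemma fvG_gnz F : measurable_fun setT F -> (forall p, 0 <= F p) ->
  \int[fvG]_eta \int[cm eta]_x F (x, eta) =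
  \int[L]_x \int[fvG]_eta (F (x, cm_add_dirac eta x) * w (x, eta)).
Proof.
move=> mF F0.
have mI := measurable_integral_id mF F0.
have I0 eta : 0 <= \int[cm eta]_x F (x, eta) by exact: integral_ge0.
rewrite integral_fvG// nneseries_recl//=; last by move=> n _; exact: integral_ge0.
(* The empty configuration contributes 0 on the left, so n+1 points on the left face n points on the
   right. *)
rewrite integral_fv0// integral_cm0 add0e.
rewrite -(@nneseries_addn _ _ 1)//; last by move=> n; exact: integral_ge0.
transitivity (\sum_(n <oo) \int[L]_x \int[fv n]_eta (F (x, cm_add_dirac eta x) * w (x, eta))).
  by apply: eq_eseriesr => n _; rewrite addn1; exact: fv_gnz.
rewrite -integral_nneseries//; last 2 first.
- move=> n; apply: (@measurable_fun_fubini_tonelli_F _ _ _ _ R (fv n) _ (mFa mF)).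
  by move=> p; rewrite mule_ge0.
- by move=> n x _; apply: integral_ge0 => eta _; rewrite mule_ge0.
apply: eq_integral => x _; rewrite -integral_fvG//.
- exact: measurable_fun_pair2 (mFa mF).
- by move=> eta; rewrite mule_ge0.
Qed.

(** Configurations are built from the empty one by adding points. This gives pathwise inequalities
    by induction on the points, with no enumeration of them. *)
Lemma fvG_closed (S : set N) : measurable S -> S (cm0 dist) ->
  (forall eta x, S eta -> S (cm_add_dirac eta x)) -> fvG (~` S) = 0.
Proof.
move=> mS S0 Sadd; rewrite /fvG/= /mseries eseries0// => n _ _.
have mSC := measurableC mS.
elim: n => [|n ih]; first by rewrite /fv/= diracE memNset//=; exact.
have mf : measurable_fun setT (fun eta => (\1_(~` S) eta)%:E : \bar R).
  by apply/measurable_EFinP; exact: measurable_indic.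
rewrite -[X in fv _ X]setIT -integral_indic// integral_fvS//.
rewrite integral0_eq ?mule0// => x _.
apply/eqP; rewrite eq_le integral_ge0 ?andbT; last by move=> eta _; rewrite mule_ge0.
rewrite -ih -[X in fv n X]setIT -integral_indic//; apply: ge0_le_integral => //.
- by move=> eta _; rewrite mule_ge0.
- apply: emeasurable_funM; last exact: measurable_fun_pair2.
  apply: (@measurableT_comp _ _ _ _ _ _ (fun eta => (\1_(~` S) eta)%:E : \bar R)) => //.
  exact: measurable_add_dirac_comp.
- move=> eta _; rewrite -[leRHS]mule1; apply: lee_pmul => //.
  rewrite lee_fin !indicE !in_setC.
  case: (boolP (eta \in S)) => [/set_mem/(Sadd _ x) h|_].
    by rewrite mem_set.
  by case: (_ \in S).
Qed.

Lemma finite_volume_gibbs : exists P : probability N R,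
  (forall F, measurable_fun setT F -> (forall p, 0 <= F p) ->
    \int[P]_eta \int[cm eta]_x F (x, eta) =
    \int[L]_x \int[P]_eta (F (x, cm_add_dirac eta x) * w (x, eta))) /\
  (forall S, measurable S -> S (cm0 dist) ->
    (forall eta x, S eta -> S (cm_add_dirac eta x)) -> P (~` S) = 0).
Proof.
have [P [c [c0 [PE intP]]]] := normalize_measure fvG_lty fvG_ge1.
exists P; split=> [F mF F0|S mS S0 Sadd]; last first.
  by rewrite PE ?fvG_closed ?mule0//; exact: measurableC.
rewrite intP; last 2 first.
- exact: measurable_integral_id.
- by move=> eta; exact: integral_ge0.
rewrite fvG_gnz// -ge0_integralZl//; last 2 first.
- apply: (@measurable_fun_fubini_tonelli_F _ _ _ _ R (finite_of fvG_lty) _ (mFa mF)).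
  by move=> p; rewrite mule_ge0.
- by move=> x _; apply: integral_ge0 => eta _; rewrite mule_ge0.
apply: eq_integral => x _; rewrite intP//.
- exact: measurable_fun_pair2 (mFa mF).
- by move=> eta; rewrite mule_ge0.
Qed.

End finite_volume.

Let one01 (p : X * N) : 0 <= cst (1 : \bar R) p <= 1.
Proof. by rewrite /= lexx lee01. Qed.

Let m1 : measurable_fun setT (cst 1 : X * N -> \bar R). Proof. by []. Qed.

(* Unnormalised: [exp (L X)] times the law of a Poisson process of intensity [L]. *)
Definition poisson (L : {finite_measure set X -> \bar R}) : {finite_measure set N -> \bar R} :=
  finite_of (fvG_lty L m1 one01).

(** * Domination by Poisson processes *)

Section domination.
Variables (P : probability N R) (lz : {measure set X -> \bar R}).
Hypothesis subgnz : forall F, measurable_fun setT F -> (forall p, 0 <= F p) ->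
  \int[P]_eta \int[cm eta]_x F (x, eta) <=
  \int[lz]_x \int[P]_eta F (x, cm_add_dirac eta x).
Variables (C D : set X) (Cb : Xb dist C) (mC : measurable C) (mD : measurable D).
Hypothesis CD : C `&` D = set0.
Hypothesis lzC : mrestr lz mC setT < +oo.

Let L := finite_of lzC.
Let E n := [set eta : N | eta C = n%:R%:E].
Let e n (eta : N) : \bar R := (\1_(E n) eta)%:E.

Let mE n : measurable (E n).
Proof.
have := measurable_eval mC measurableT (emeasurable_set1 n%:R%:E).
by rewrite setTI.
Qed.

Let me n : measurable_fun setT (e n).
Proof. by rewrite /e; apply/measurable_EFinP; exact: measurable_indic. Qed.

Let e0 n eta : 0 <= e n eta. Proof. by rewrite lee_fin. Qed.

Let restr_addD eta x : C x -> eqm (cm_restr mD (cm_add_dirac eta x)) (cm_restr mD eta).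
Proof.
move=> Cx B mB; rewrite !cm_restrE cm_add_diracE diracE memNset ?adde0// => -[_ Dx].
by have : (C `&` D) x by []; rewrite CD.
Qed.

Let restr_addC eta x : C x ->
  eqm (cm_restr mC (cm_add_dirac eta x)) (cm_add_dirac (cm_restr mC eta) x).
Proof.
move=> Cx B mB; rewrite !cm_add_diracE !cm_restrE cm_add_diracE !diracE in_setI.
by rewrite (mem_set Cx) andbT.
Qed.

Let e_add n eta x : C x -> e n.+1 (cm_add_dirac eta x) = e n eta.
Proof.
move=> Cx; have [k kE] := cm_int eta Cb.
rewrite /e !indicE; congr ((nat_of_bool _)%:R%:E).
apply/idP/idP => /set_mem h; apply/mem_set; move: h.
  rewrite /E/= cm_add_diracE kE diracE mem_set// => -[] /eqP.
  by rewrite natr1 eqr_nat eqSS => /eqP ->.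
by rewrite /E/= cm_add_diracE => ->; rewrite diracE mem_set// -EFinD natr1.
Qed.

Let mHr (H : N * N -> \bar R) : measurable_fun setT H ->
  measurable_fun setT (fun eta => H (cm_restr mD eta, cm_restr mC eta)).
Proof.
move=> mH; apply: (measurableT_comp mH); apply: measurable_fun_pair => //.
  exact: measurable_cm_restr.
exact: measurable_cm_restr.
Qed.

Let mHs (H : N * N -> \bar R) : measurable_fun setT H ->
  measurable_fun setT (fun p : N * N => H (cm_restr mD p.2, p.1)).
Proof.
move=> mH; apply: (measurableT_comp mH); apply: measurable_fun_pair => //.
exact: (measurableT_comp (measurable_cm_restr mD) measurable_snd).
Qed.

Let mHi (H : N * N -> \bar R) : measurable_fun setT H -> (forall p, 0 <= H p) ->
  measurable_fun setT (fun zeta => \int[P]_eta H (cm_restr mD eta, zeta)).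
Proof.
move=> mH H0; exact: (@measurable_fun_fubini_tonelli_F _ _ _ _ R P _ (mHs mH)).
Qed.

(** Induction on the number of points in [C]. With n+1 of them, marking each and dividing by n+1
    changes nothing, and [subgnz] trades the marked point [x] for an integral over [C]. The
    configuration in [D] does not see [x], as [C] and [D] are disjoint; in [C] it is absorbed into
    the test function [Hx], so [H] must stay general. *)
Lemma domination_card n (H : N * N -> \bar R) :
  measurable_fun setT H -> (forall p, 0 <= H p) ->
  \int[P]_eta (e n eta * H (cm_restr mD eta, cm_restr mC eta)) <=
  \int[fv L m1 one01 n]_zeta \int[P]_eta H (cm_restr mD eta, zeta).
Proof.
elim: n H => [|n ih] H mH H0.
  rewrite integral_fv0; last exact: mHi.
  apply: ge0_le_integral => //.
  - by move=> eta _; rewrite mule_ge0.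
  - by apply: emeasurable_funM => //; exact: mHr.
  - by apply: (measurableT_comp mH); apply: measurable_fun_pair => //; exact: measurable_cm_restr.
  - move=> eta _; rewrite /e indicE.
    case: (boolP (_ \in _)) => [/set_mem h|_]; last by rewrite mul0e.
    rewrite mul1e (_ : H _ = H (cm_restr mD eta, cm0 dist))//.
    apply: (@eqm_measurable_fun (fun z => H (cm_restr mD eta, z))).
      exact: measurable_fun_pair2.
    move=> B mB; rewrite cm_restrE; apply/eqP; rewrite eq_le measure_ge0 andbT.
    apply: (@le_trans _ _ (eta C)); last by rewrite h.
    by apply: le_measurable => //; exact: measurableI.
pose F (p : X * N) := (\1_C p.1)%:E * (e n.+1 p.2 * H (cm_restr mD p.2, cm_restr mC p.2)).
have mF : measurable_fun setT F.
  apply: emeasurable_funM.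
    by apply/measurable_EFinP; apply: measurableT_comp => //; exact: measurable_indic.
  apply: emeasurable_funM; first exact: (measurableT_comp (me n.+1) measurable_snd).
  exact: (measurableT_comp (mHr mH) measurable_snd).
have F0 p : 0 <= F p by rewrite !mule_ge0// lee_fin.
have -> : \int[P]_eta (e n.+1 eta * H (cm_restr mD eta, cm_restr mC eta)) =
    (n.+1%:R^-1)%:E * \int[P]_eta \int[cm eta]_x F (x, eta).
  rewrite -ge0_integralZl//; last 2 first.
  - exact: measurable_integral_id.
  - by move=> eta _; exact: integral_ge0.
  apply: eq_integral => eta _; rewrite /F/=.
  rewrite ge0_integralZr//; last 2 first.
  - by apply/measurable_EFinP; exact: measurable_indic.
  - by rewrite mule_ge0.
  rewrite integral_indic// setIT /e indicE.
  case: (boolP (_ \in _)) => [/set_mem h|_]; last by rewrite !mul0e !mule0.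
  by rewrite h mul1e muleA -EFinM mulVf// mul1e.
rewrite integral_fvS//; last 2 first.
- exact: mHi.
- by move=> zeta; exact: integral_ge0.
rewrite lee_wpmul2l ?lee_fin//; apply: le_trans (subgnz mF F0) _.
pose G zeta := \int[P]_eta H (cm_restr mD eta, zeta).
have mG : measurable_fun setT (fun p : X * N => G (cm_add_dirac p.2 p.1) * cst 1 p).
  apply: emeasurable_funM => //; apply: (measurableT_comp (mHi mH H0)).
  exact: measurable_add_dirac_comp.
have mK := @measurable_fun_fubini_tonelli_F _ _ _ _ R (fv L m1 one01 n) _ mG.
rewrite [leRHS]integral_restr//; last 2 first.
- by apply: mK => p; rewrite mule_ge0//; exact: integral_ge0.
- by move=> x; apply: integral_ge0 => zeta _; rewrite mule_ge0//; exact: integral_ge0.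
rewrite [leRHS]integral_mkcond.
apply: ge0_le_integral => //.
- by move=> x _; exact: integral_ge0.
- apply: (@measurable_fun_fubini_tonelli_F _ _ _ _ R P
    (fun p => F (p.1, cm_add_dirac p.2 p.1))) => //.
  by apply: measurable_comp2 => //; exact: measurable_add_dirac_comp.
- apply/(measurable_restrictT _ mC)/measurable_funTS.
  by apply: mK => p; rewrite mule_ge0//; exact: integral_ge0.
- move=> x _; rewrite patchE; case: ifPn => xC; last first.
    rewrite integral0_eq// => eta _.
    by rewrite /F/= indicE (negbTE xC) mul0e.
  have Cx := set_mem xC.
  pose Hx p := H (p.1, cm_add_dirac p.2 x).
  have mHx : measurable_fun setT Hx.
    apply: (measurableT_comp mH); apply: measurable_fun_pair => //.
    exact: measurable_add_dirac_comp.
  under [leRHS]eq_integral do rewrite mule1.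
  apply: le_trans (ih Hx mHx (fun p => H0 _)).
  rewrite le_eqVlt; apply/orP; left; apply/eqP; apply: eq_integral => eta _.
  rewrite /F/= indicE xC mul1e e_add//; congr (_ * _).
  rewrite /Hx/=.
  rewrite (@eqm_measurable_fun (fun z => H (z, cm_restr mC (cm_add_dirac eta x))) _ _ _
    (restr_addD eta Cx)); last exact: measurable_fun_pair1.
  apply: (@eqm_measurable_fun (fun z => H (cm_restr mD eta, z))); last exact: restr_addC.
  exact: measurable_fun_pair2.
Qed.

(** [C] is bounded, so the events [E n] partition the configurations, and the bounds for each [n]
    add up to the whole Poisson measure. *)
Lemma domination (H : N * N -> \bar R) :
  measurable_fun setT H -> (forall p, 0 <= H p) ->
  \int[P]_eta H (cm_restr mD eta, cm_restr mC eta) <=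
  \int[poisson L]_zeta \int[P]_eta H (cm_restr mD eta, zeta).
Proof.
move=> mH H0; rewrite [leRHS]integral_fvG//; last 2 first.
- exact: mHi.
- by move=> zeta; exact: integral_ge0.
have UE : \bigcup_n E n = setT.
  by apply/seteqP; split => // eta _; have [n nE] := cm_int eta Cb; exists n.
rewrite -{1}UE ge0_integral_bigcup//; last 2 first.
- by apply: measurable_funTS; exact: mHr.
- apply/trivIsetP => i j _ _ ij; apply/seteqP; split => // eta [].
  by rewrite /E/= => -> [] /eqP; rewrite eqr_nat (negbTE ij).
apply: lee_nneseries => [n _ _|n _]; first exact: integral_ge0.
rewrite integral_mkcond; apply: le_trans (domination_card n mH H0).
rewrite le_eqVlt; apply/orP; left; apply/eqP; apply: eq_integral => eta _.
by rewrite patchE /e indicE; case: ifPn; rewrite ?mul1e ?mul0e.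
Qed.

End domination.

(** * Extension of local marginals *)

Section projective_limit.
Hypothesis La0 : La 0%N = set0.
Hypothesis La_bdd : forall B, Xb dist B -> exists k, B `<=` La k.

Lemma measurable_La k : measurable (La k). Proof. by have [] := La_b k. Qed.

Let mLa := measurable_La.

Definition cell k := La k.+1 `\` La k.

Lemma measurable_cell k : measurable (cell k). Proof. exact: measurableD. Qed.

Definition pr k : N -> N := cm_restr (mLa k).
Definition cpr k : N -> N := cm_restr (measurable_cell k).
(** Both arguments are restricted before being added, so that every pair can be glued, whatever its
    supports. *)
Definition cm_glue k (q : N * N) : N := cm_add (pr k q.1) (cpr k q.2).

Lemma measurable_pr k : measurable_fun setT (pr k). Proof. exact: measurable_cm_restr. Qed.
Lemma measurable_cpr k : measurable_fun setT (cpr k). Proof. exact: measurable_cm_restr. Qed.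
Lemma measurable_glue k : measurable_fun setT (cm_glue k).
Proof.
have h : measurable_fun setT (fun q : N * N => (pr k q.1, cpr k q.2)).
  apply: measurable_fun_pair.
    exact: (measurableT_comp (measurable_pr k) measurable_fst).
  exact: (measurableT_comp (measurable_cpr k) measurable_snd).
exact: (measurableT_comp measurable_cm_add h).
Qed.

Lemma pr_pr i j eta : (i <= j)%N -> eqm (pr i (pr j eta)) (pr i eta).
Proof.
move=> ij B mB; rewrite /pr !cm_restrE -setIA; congr (cm eta (_ `&` _)).
by apply/setIidPl; exact: La_nd.
Qed.

Lemma eqm_sym eta xi : eqm eta xi -> eqm xi eta.
Proof. by move=> e B mB; rewrite e. Qed.

Lemma pr_glue k q : eqm (pr k (cm_glue k q)) (pr k q.1).
Proof.
move=> B mB; rewrite /pr/cm_glue/cpr !(cm_restrE,cm_addE) -!setIA setIid.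
by rewrite /cell setDE (setIC (La k)) -setIA setICl !setI0 measure0 adde0.
Qed.

Lemma pr_glueS k q B : pr k.+1 (cm_glue k q) B = pr k q.1 B + cpr k q.2 B.
Proof.
transitivity (pr k q.1 (B `&` La k.+1) + cpr k q.2 (B `&` La k.+1)); first exact: cm_addE.
rewrite /pr/cpr !cm_restrE; congr (_ + _); congr (cm _ _).
  by apply/seteqP; split => [x [[? ?] ?]|x [? ?]]; do !split => //; exact: La_nd (leqnSn k) _ _.
by apply/seteqP; split => [x [[? ?] ?]|x [? [? ?]]]; do !split => //.
Qed.

Lemma glue_pr k eta : eqm (cm_glue k (pr k eta, cpr k eta)) (pr k.+1 eta).
Proof.
move=> B mB; rewrite /pr/cm_glue/cpr !(cm_restrE,cm_addE).
have setIK (D : set X) : B `&` D `&` D = B `&` D by rewrite -setIA setIid.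
rewrite !setIK -measureU.
- rewrite -setIUr; congr (cm eta (_ `&` _)).
  by rewrite /cell setDUK//; exact: La_nd.
- exact: measurableI.
- by apply: measurableI => //; exact: measurable_cell.
- by apply/seteqP; split => // x [[_ h1] [_ [_ h2]]].
Qed.

Definition cyl k (A : set N) := measurable A /\ forall eta, A eta <-> A (pr k eta).

Lemma cyl_le i j A : (i <= j)%N -> cyl i A -> cyl j A.
Proof.
move=> ij [mA hA]; split => // eta.
rewrite (hA eta) (hA (pr j eta)); split; apply: eqm_measurable => //.
  by apply: eqm_sym; exact: pr_pr.
exact: pr_pr.
Qed.

Lemma cyl_preimage k A : measurable A -> cyl k (pr k @^-1` A).
Proof.
move=> mA; split.
  by rewrite -[X in measurable X]setTI; exact: measurable_pr.
move=> eta /=; split; apply: eqm_measurable => //.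
  by apply: eqm_sym; exact: pr_pr.
exact: pr_pr.
Qed.

Lemma cyl_setT k : cyl k setT. Proof. by split. Qed.

Lemma cylC k A : cyl k A -> cyl k (~` A).
Proof.
move=> [mA hA]; split => [|eta]; first exact: measurableC.
by split => h Ax; apply: h; exact/(hA eta).
Qed.

Lemma cylI k A B : cyl k A -> cyl k B -> cyl k (A `&` B).
Proof.
move=> [mA hA] [mB hB]; split => [|eta]; first exact: measurableI.
by split => -[/(hA eta) ? /(hB eta) ?].
Qed.

Definition cylinder (A : set N) := exists k, cyl k A.

Lemma cylinder0 : cylinder set0. Proof. by exists 0%N; split. Qed.

Lemma cylinderC A : cylinder A -> cylinder (~` A).
Proof. by move=> [k kA]; exists k; exact: cylC. Qed.

Lemma cylinderI A B : cylinder A -> cylinder B -> cylinder (A `&` B).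
Proof.
move=> [i iA] [j jB]; exists (maxn i j); apply: cylI.
  by apply: cyl_le iA; exact: leq_maxl.
by apply: cyl_le jB; exact: leq_maxr.
Qed.

Lemma cylinderU A B : cylinder A -> cylinder B -> cylinder (A `|` B).
Proof.
move=> cA cB; rewrite -(setCK (A `|` B)) setCU.
by apply: cylinderC; apply: cylinderI; exact: cylinderC.
Qed.

(** Each count [eta B] is the increasing limit of the counts in [B] cut to [La k], and these are
    cylinder functions. *)
Lemma measurable_cylinder : @measurable _ N = <<s cylinder >>.
Proof.
apply/seteqP; split; last first.
  apply: smallest_sub; first exact: sigma_algebra_measurable.
  by move=> A [k []].
apply: smallest_sub; first exact: smallest_sigma_algebra.
move=> _ [B mB [Y mY <-]].
pose T := g_sigma_algebraType cylinder.
have mpr k : measurable_fun (setT : set T) (fun eta : N => pr k eta B).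
  move=> _ Z mZ; rewrite setTI; apply: sub_sigma_algebra; exists k.
  apply: (cyl_preimage k (A := [set eta | Z (cm eta B)])).
  by have := measurable_eval mB measurableT mZ; rewrite setTI.
have mE : measurable_fun (setT : set T) (fun eta : N => cm eta B).
  apply: (emeasurable_fun_cvg (fun k (eta : T) => pr k eta B)) => // eta _.
  rewrite -[X in cm eta X]setIT -La_cover setI_bigcupr.
  apply: nondecreasing_cvg_mu.
  - by move=> k; exact: measurableI.
  - by apply: bigcupT_measurable => k; exact: measurableI.
  - by move=> i j ij; apply/subsetPset; apply: setIS; exact: La_nd.
exact: mE.
Qed.

(* [p_ k] is the marginal on [La k], [Q_ k] its joint law with the marginal on the cell
   [La k.+1 `\` La k]. Absolute continuity of [Q_ k] with respect to a product replaces
   the regular conditional probabilities. *)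
Section Ionescu_Tulcea.
Variables (p_ nu_ : nat -> {finite_measure set N -> \bar R}).
Variable Q_ : nat -> {measure set (N * N) -> \bar R}.
Hypothesis HQle : forall k A, measurable A -> Q_ k A <= (p_ k \x nu_ k) A.
Hypothesis HQp : forall k A, measurable A -> Q_ k (A `*` setT) = p_ k A.
Hypothesis HQg : forall k A, measurable A -> p_ k.+1 A = Q_ k (cm_glue k @^-1` A).

(** In a glued configuration an event of [La k] sees only the first component, whose law is
    [p_ k]. *)
Lemma cyl_consistent k A : cyl k A -> p_ k.+1 A = p_ k A.
Proof.
move=> [mA hA]; rewrite HQg// -HQp//; congr (Q_ k _).
apply/seteqP; split => [[x y] /=|[x y] /= [Ax _]].
  move=> Ag; split => //; apply/hA; move/hA : Ag.
  by apply: eqm_measurable => //; exact: pr_glue.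
apply/hA; move/hA : Ax; apply: eqm_measurable => //.
by apply: eqm_sym; exact: pr_glue.
Qed.

Lemma cyl_consistent_le i j A : (i <= j)%N -> cyl i A -> p_ j A = p_ i A.
Proof.
move=> /subnK <-; elim: (j - i)%N => [|n ih] cA; first by rewrite add0n.
rewrite addSn cyl_consistent ?ih//; apply: cyl_le cA; exact: leq_addl.
Qed.

Section decreasing.
Variable h : nat -> N * N -> \bar R.
Hypothesis mh : forall k, measurable_fun setT (h k).
Hypothesis h0 : forall k q, 0 <= h k q.
Hypothesis hfin : forall k q, h k q \is a fin_num.
Hypothesis h1 : forall k x, \int[nu_ k]_y h k (x, y) <= 1.
Hypothesis hQ : forall k f, measurable_fun setT f -> (forall q, 0 <= f q) ->
  \int[Q_ k]_q f q = \int[p_ k]_x \int[nu_ k]_y (f (x, y) * h k (x, y)).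
Variable A : nat -> set N.
Hypothesis cA : forall m, cyl m (A m).
Hypothesis A_nd : forall m, A m.+1 `<=` A m.

Let Tk k (f : N -> \bar R) x := \int[nu_ k]_y (f (cm_glue k (x, y)) * h k (x, y)).

(* The conditional probability of [A (k + j)] given the configuration in [La k]. *)
Fixpoint Phi j k : N -> \bar R :=
  if j is i.+1 then Tk k (Phi i k.+1) else fun x => (\1_(A k) x)%:E.

Let mTf k f : measurable_fun setT f ->
  measurable_fun setT (fun q : N * N => f (cm_glue k q) * h k q).
Proof.
move=> mf; apply: emeasurable_funM => //.
exact: (measurableT_comp mf (measurable_glue k)).
Qed.

Let mTf2 k f x : measurable_fun setT f ->
  measurable_fun setT (fun y : N => f (cm_glue k (x, y)) * h k (x, y)).
Proof.
move=> mf; apply: emeasurable_funM; last exact: measurable_fun_pair2.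
apply: (measurableT_comp mf); apply: (measurableT_comp (measurable_glue k)).
exact: measurable_fun_pair.
Qed.

Let mT k f : measurable_fun setT f -> (forall x, 0 <= f x) -> measurable_fun setT (Tk k f).
Proof.
move=> mf f0; apply: (@measurable_fun_fubini_tonelli_F _ _ _ _ R (nu_ k) _ (mTf k mf)).
by move=> q; rewrite mule_ge0.
Qed.

Let intT k f : measurable_fun setT f -> (forall x, 0 <= f x) ->
  \int[p_ k]_x Tk k f x = \int[p_ k.+1]_x f x.
Proof.
move=> mf f0.
have E := @hQ k _ (measurableT_comp mf (measurable_glue k)) (fun q => f0 (cm_glue k q)).
rewrite -[LHS]E {E}.
rewrite -(integral_image _ (measurable_glue k))//.
by apply: eq_measure_integral => B mB _; rewrite HQg.
Qed.

Let Phi_prop j : forall k, measurable_fun setT (Phi j k) /\ (forall x, 0 <= Phi j k x <= 1).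
Proof.
elim: j => [|j ih] k /=.
  split.
    by apply/measurable_EFinP; apply: measurable_indic; have [] := cA k.
  by move=> x; rewrite !lee_fin indicE; case: (_ \in _); rewrite ?lexx ?ler01.
have [mP P01] := ih k.+1.
have P0 x : 0 <= Phi j k.+1 x by have /andP[] := P01 x.
split; first exact: mT.
move=> x; apply/andP; split; first by apply: integral_ge0 => y _; rewrite mule_ge0.
apply: le_trans (h1 k x); apply: ge0_le_integral => //.
- by move=> y _; rewrite mule_ge0.
- exact: mTf2.
- exact: measurable_fun_pair2.
- by move=> y _; rewrite -[leRHS]mul1e lee_wpmul2r//; have /andP[] := P01 (cm_glue k (x, y)).
Qed.

Let mPhi j k : measurable_fun setT (Phi j k). Proof. by have [] := Phi_prop j k. Qed.
Let Phi0 j k x : 0 <= Phi j k x. Proof. by have [_ /(_ x)/andP[]] := Phi_prop j k. Qed.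
Let Phi1 j k x : Phi j k x <= 1. Proof. by have [_ /(_ x)/andP[]] := Phi_prop j k. Qed.

Let intPhi j k : \int[p_ k]_x Phi j k x = p_ (k + j)%N (A (k + j)%N).
Proof.
elim: j k => [|j ih] k /=.
  by rewrite addn0 integral_indic ?setIT//; have [] := cA k.
by rewrite intT// ih addSnnS.
Qed.

Let Phi_nd j k x : Phi j.+1 k x <= Phi j k x.
Proof.
elim: j k x => [|j ih] k x.
  rewrite /= indicE; case: (boolP (_ \in _)) => xA; first exact: (Phi1 1 k x).
  rewrite /Tk/= integral0_eq// => y _; rewrite indicE memNset ?mul0e// => /A_nd Ag.
  move/negP : xA; apply; apply/mem_set; have [mA hA] := cA k.
  apply/hA; move/hA : Ag; apply: eqm_measurable => //; exact: pr_glue.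
rewrite [leLHS]/= [leRHS]/=; apply: ge0_le_integral => //.
- by move=> y _; rewrite mule_ge0//; exact: (Phi0 j.+1).
- exact: (mTf2 k x (mPhi j.+1 k.+1)).
- exact: (mTf2 k x (mPhi j k.+1)).
- by move=> y _; rewrite lee_wpmul2r//; exact: ih.
Qed.

Let Phi_ndle k x i j : (i <= j)%N -> Phi j k x <= Phi i k x.
Proof.
move=> /subnK <-; elim: (j - i)%N => // n ihn; rewrite addSn.
exact: le_trans (Phi_nd _ _ _) ihn.
Qed.

Let phi k x := limn (fun j => Phi j k x).

Let cvg_phi k x : Phi j k x @[j --> \oo] --> phi k x.
Proof. by apply: ereal_nonincreasing_is_cvgn => i j; exact: Phi_ndle. Qed.

Let phi_le j k x : phi k x <= Phi j k x.
Proof.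
apply: lime_le; first exact: cvg_phi.
by exists j => // i /= ji; exact: Phi_ndle.
Qed.

Let phiA k x : 0 < phi k x -> A k x.
Proof.
move=> /lt_le_trans/(_ (phi_le 0 k x)); rewrite /= indicE.
by case: (boolP (_ \in _)) => [/set_mem//|_]; rewrite ltxx.
Qed.

Let phi0 k x : 0 <= phi k x.
Proof. by apply: lime_ge; [exact: cvg_phi|exact: nearW]. Qed.

(** Dominated convergence with bound [h k (x, .)]: if the limit vanished at every extension of [x],
    it would vanish at [x]. *)
Let phi_next k x : 0 < phi k x -> exists y, 0 < phi k.+1 (cm_glue k (x, y)).
Proof.
move=> phx; apply: contrapT => /forallNP hn.
have phi0E y : phi k.+1 (cm_glue k (x, y)) = 0.
  by apply/eqP; rewrite eq_le phi0 andbT leNgt; apply/negP; exact: hn.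
have : \int[nu_ k]_y (Phi j k.+1 (cm_glue k (x, y)) * h k (x, y)) @[j --> \oo] --> 0.
  rewrite -(_ : \int[nu_ k]_y (fun=> 0) y = 0); last by rewrite integral0_eq.
  have mf j : measurable_fun setT (fun y => Phi j k.+1 (cm_glue k (x, y)) * h k (x, y)).
    exact: (mTf2 k x (mPhi j k.+1)).
  have hint : (nu_ k).-integrable setT (fun y => h k (x, y)).
    apply/integrableP; split; first exact: measurable_fun_pair2.
    under eq_integral do rewrite gee0_abs//.
    by rewrite (le_lt_trans (h1 k x))// ltry.
  have ae1 : {ae nu_ k, forall y, setT y ->
      Phi j k.+1 (cm_glue k (x, y)) * h k (x, y) @[j --> \oo] --> (fun=> 0 : \bar R) y}.
    apply: aeW => y _; rewrite -(mul0e (h k (x, y))) -(phi0E y).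
    by apply: cvgeZr => //; exact: cvg_phi.
  have ae2 : {ae nu_ k, forall y n, setT y ->
      `|Phi n k.+1 (cm_glue k (x, y)) * h k (x, y)| <= h k (x, y)}.
    apply: aeW => y n _; rewrite gee0_abs ?mule_ge0//.
    by rewrite -[leRHS]mul1e lee_wpmul2r.
  by have [] := dominated_convergence measurableT mf (measurable_cst _) ae1 hint ae2.
move=> c0; suff : phi k x = 0 by move=> E; rewrite E ltxx in phx.
apply/cvg_lim => //; rewrite -(cvg_shiftS (fun j => Phi j k x)); exact: c0.
Qed.

(** If [phi 0] vanished everywhere, the probabilities of the [A m] would tend to 0; so some start
    has a positive limit, and positivity propagates cell by cell. It forces [xi m] into [A m], and
    the sum of all chosen cells agrees with [xi m] on [La m]. *)
Lemma decreasing_nonempty (e : R) : (0 < e)%R -> (forall m, e%:E <= p_ m (A m)) ->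
  exists eta, forall m, A m eta.
Proof.
move=> e0 ep.
have [x0 phx0] : exists x, 0 < phi 0 x.
  apply: contrapT => /forallNP hn.
  have phi0E x : phi 0 x = 0.
    by apply/eqP; rewrite eq_le phi0 andbT leNgt; apply/negP; exact: hn.
  have ae1 : {ae p_ 0, forall y, setT y ->
      Phi j 0 y @[j --> \oo] --> (fun=> 0 : \bar R) y}.
    by apply: aeW => y _; rewrite -(phi0E y); exact: cvg_phi.
  have ae2 : {ae p_ 0, forall y n, setT y -> `|Phi n 0 y| <= cst 1 y}.
    by apply: aeW => y n _; rewrite gee0_abs.
  have int1 : (p_ 0).-integrable setT (cst 1).
    exact: finite_measure_integrable_cst.
  have [_ _] := dominated_convergence measurableT (fun j => mPhi j 0)
    (measurable_cst _) ae1 int1 ae2.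
  rewrite [X in _ --> X]integral0_eq// => c0.
  have : e%:E <= 0.
    rewrite -(cvg_lim _ c0)//; apply: lime_ge; first by apply/cvg_ex; exists 0.
    apply: nearW => j /=; have := intPhi j 0; rewrite add0n => ->; exact: ep.
  by rewrite lee_fin leNgt e0.
have /choice[nx nxP] : forall kx : nat * N, exists y,
    0 < phi kx.1 kx.2 -> 0 < phi kx.1.+1 (cm_glue kx.1 (kx.2, y)).
  move=> [k x]/=; case: (pselect (0 < phi k x)) => [/phi_next[y hy]|hn]; first by exists y.
  (* An arbitrary default where the limit is not positive. *)
  by exists x.
pose xi := fix xi k := if k is i.+1 then cm_glue i (xi i, nx (i, xi i)) else x0.
have phxi k : 0 < phi k (xi k) by elim: k => //= k ih; exact: (nxP (k, xi k)).
pose zt k := cpr k (nx (k, xi k)).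
(* As [La 0] is empty, nothing of [x0] is left besides the chosen cells. *)
have prxi k B : measurable B -> pr k (xi k) B = \sum_(j < k) zt j B.
  elim: k B => [|k ih] B mB.
    by rewrite big_ord0 /pr cm_restrE La0 setI0 measure0.
  by rewrite big_ord_recr/= -ih//; exact: (pr_glueS k (xi k, nx (k, xi k))).
(* Only finitely many cells meet a bounded set, which keeps this infinite sum integer-valued
   there. *)
pose et := mseries (fun k => cm (zt k)) 0.
have zt0 j k B : (k <= j)%N -> B `<=` La k -> zt j B = 0.
  move=> kj BL; rewrite /zt/cpr cm_restrE (_ : _ `&` _ = set0) ?measure0//.
  by apply/seteqP; split => // y [/BL/(La_nd kj) yj [_]].
have etE k B : B `<=` La k -> et B = \sum_(j < k) zt j B.
  move=> BL; rewrite /et/mseries (nneseries_split 0 k)//= eseries0 ?adde0 ?big_mkord//.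
  by move=> i ki _; apply: zt0 BL; rewrite add0n in ki.
have et_int B : Xb dist B -> exists n : nat, et B = n%:R%:E.
  move=> Bb; have [k BL] := La_bdd Bb.
  rewrite (etE k)//; elim: k {BL} => [|k [n ih]]; first by exists 0%N; rewrite big_ord0.
  have [m mE] := cm_int (zt k) Bb.
  by exists (n + m)%N; rewrite big_ord_recr/= ih mE -EFinD natrD.
exists (CMeasure et_int) => m; have [mA hA] := cA m; apply: (hA _).2.
have := (hA _).1 (phiA (phxi m)).
apply: eqm_measurable => // B mB; rewrite prxi//.
transitivity (et (B `&` La m)); last by [].
rewrite (etE m)//.
apply: eq_bigr => j _.
rewrite /zt/cpr !cm_restrE; congr (cm _ _); apply/seteqP.
split => [y [yB yj]|y [[yB _] yj]]; split => //; split => //.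
by case: yj => [yj _]; exact: La_nd yj.
Qed.

End decreasing.

Lemma decreasing_cylinders (A : nat -> set N) (e : R) : (0 < e)%R ->
  (forall m, cyl m (A m)) -> (forall m, A m.+1 `<=` A m) ->
  (forall m, e%:E <= p_ m (A m)) -> exists eta, forall m, A m eta.
Proof.
move=> e0 cA ndA ep.
have /choice[h hP] := fun k => kernel_density (HQle k) (HQp k).
by apply: (@decreasing_nonempty h _ _ _ _ _ A cA ndA e e0 ep) => k; have [] := hP k.
Qed.

(** An alias whose set structure is the algebra of cylinders, for the extension theorem, while [N]
    keeps its sigma-algebra. *)
Definition cyl_space : Type := N.
HB.instance Definition _ := Pointed.on cyl_space.
HB.instance Definition _ := @isAlgebraOfSets.Build cm_display cyl_space cylinder
  cylinder0 cylinderU cylinderC.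

Hypothesis p1 : forall k, p_ k setT = 1.

(** The level at which [A] is a cylinder is chosen arbitrarily; consistency makes the value
    independent of it. *)
Let mu (A : set cyl_space) : \bar R :=
  if pselect (cylinder A) is left h then p_ (projT1 (cid h)) A else 0.

Let muE k A : cyl k A -> mu A = p_ k A.
Proof.
move=> cA; rewrite /mu; case: pselect => [h|]; last by case; exists k.
case: cid => j /= jA; rewrite -(cyl_consistent_le (leq_maxl j k) jA).
by rewrite (cyl_consistent_le (leq_maxr j k) cA).
Qed.

Let mu_le A B : cylinder A -> cylinder B -> A `<=` B -> mu A <= mu B.
Proof.
move=> [i iA] [j jB] AB.
have cA := cyl_le (leq_maxl i j) iA; have cB := cyl_le (leq_maxr i j) jB.
rewrite (muE cA) (muE cB); apply: le_measurable => //; [by case: cA|by case: cB].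
Qed.

Let mu0 A : 0 <= mu A.
Proof. by rewrite /mu; case: pselect. Qed.

Let muD A B : cylinder A -> cylinder B -> [disjoint A & B] ->
  mu (A `|` B) = mu A + mu B.
Proof.
move=> [i iA] [j jB] AB.
have cA := cyl_le (leq_maxl i j) iA; have cB := cyl_le (leq_maxr i j) jB.
have cU : cyl (maxn i j) (A `|` B).
  by rewrite -(setCK (A `|` B)) setCU; apply: cylC; apply: cylI; exact: cylC.
rewrite (muE cA) (muE cB) (muE cU) measureU//; [by case: cA|by case: cB|].
exact/disj_set2P.
Qed.

Let muT : mu setT < +oo.
Proof. by rewrite (muE (cyl_setT 0)) p1 ltry. Qed.

Let mu_cvg0 (A : (set N)^nat) : (forall n, cylinder (A n)) ->
  (forall m n, (m <= n)%N -> A n `<=` A m) -> \bigcap_n A n = set0 ->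
  mu (A n) @[n --> \oo] --> 0.
Proof.
move=> /[dup] cA /choice[k kA] ndA A0.
have cvgA : cvg (mu (A n) @[n --> \oo]).
  by apply: ereal_nonincreasing_is_cvgn => i j ij; apply: mu_le => //; exact: ndA.
set l := lim (mu (A n) @[n --> \oo]) in cvgA *.
have l0 : 0 <= l by apply: lime_ge => //; exact: nearW.
have lA n : l <= mu (A n).
  apply: lime_le => //; exists n => // j /= nj.
  by apply: mu_le => //; exact: ndA.
have [lE|lneq0] := eqVneq l 0; first by move: cvgA; rewrite lE.
have lfin : l \is a fin_num.
  rewrite ge0_fin_numE// (le_lt_trans (lA 0%N))// (le_lt_trans _ muT)//.
  by apply: mu_le => //; exists 0%N; exact: cyl_setT.
(* [A m] may be a cylinder of a level above [m]. Keeping at stage [j] only the sets of index and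
   level at most [j] puts a decreasing sequence at the right levels, with larger sets and the same
   intersection. *)
pose B j := \bigcap_(m in [set m | (m <= j)%N && (k m <= j)%N]) A m.
have cB j : cyl j (B j).
  split.
    by apply: bigcap_measurableType => m _; have [i []] := cA m.
  move=> eta; split => Bj m /= /[dup] mj /Bj; have /andP[_ kj] := mj.
    by move=> h; apply: ((cyl_le kj (kA m)).2 _).1.
  by move=> h; apply: ((cyl_le kj (kA m)).2 _).2.
have e0 : (0 < fine l)%R by rewrite -lte_fin fineK// lt_neqAle eq_sym lneq0.
have ndB j : B j.+1 `<=` B j.
  move=> eta Bj m /= /andP[mj kj]; apply: Bj => /=.
  by rewrite (leq_trans mj)// (leq_trans kj).
have leB j : (fine l)%:E <= p_ j (B j).
  rewrite fineK// -(muE (cB j)); apply: le_trans (lA j) _.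
  apply: mu_le => //; first by exists j.
  by move=> eta Aj m /= /andP[mj _]; exact: ndA mj _ Aj.
have [eta etaB] := decreasing_cylinders e0 cB ndB leB.
have : (\bigcap_n A n) eta.
  move=> m _; apply: (etaB (maxn m (k m))) => /=.
  by rewrite leq_maxl leq_maxr.
by rewrite A0.
Qed.

Lemma projective_limit : exists P : probability N R,
  forall k A, cyl k A -> P A = p_ k A.
Proof.
pose mum : {measure set cyl_space -> \bar R} := HB.pack_for (measure cyl_space R) mu
  (isMeasure.Build cm_display cyl_space R mu
    (@content0 _ cyl_space R mu mu0 muD muT) mu0
    (@content_sigma_additive _ cyl_space R mu mu0 muD muT mu_cvg0)).
pose P (A : set N) := measure_extension mum A.
have PE k A : cyl k A -> P A = p_ k A.
  move=> cA; rewrite -(muE cA); apply: (@measurable_mu_extE _ _ _ mum).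
  by exists k.
have P0 : P set0 = 0 by exact: (measure0 (measure_extension mum)).
have Pge0 A : 0 <= P A by exact: (measure_ge0 (measure_extension mum)).
have Psig : semi_sigma_additive P.
  move=> F mF tF mUF; apply: (@measure_semi_sigma_additive _ _ _ (measure_extension mum)) => //.
  - by move=> i; have := mF i; rewrite measurable_cylinder.
  - by move: mUF; rewrite measurable_cylinder.
have PT : P setT = 1 by rewrite (PE 0%N)// ?p1//; exact: cyl_setT.
pose Pm : {measure set N -> \bar R} := HB.pack_for (measure N R) P
  (isMeasure.Build cm_display N R P P0 Pge0 Psig).
pose Pp : probability N R := HB.pack_for (probability N R) P
  (Measure.class Pm) (@Measure_isProbability.Build cm_display N R Pm PT).
by exists Pp.
Qed.

End Ionescu_Tulcea.
End projective_limit.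
End exhaustion.
End counting_measures.

(** * Thermodynamic limit *)

Lemma measurable_expeR (R : realType) : measurable_fun setT (@expeR R).
Proof.
rewrite (_ : @expeR R = fun x => if x == +oo then +oo else if x == -oo then 0
  else (expR (fine x))%:E); last by apply/funext => -[r| |].
apply: measurable_fun_ifT => //.
  by apply: (measurable_fun_bool true); rewrite setTI (_ : _ @^-1` _ = [set +oo]);
    [exact: emeasurable_set1|apply/seteqP; split => x /= /eqP].
apply: measurable_fun_ifT => //.
  by apply: (measurable_fun_bool true); rewrite setTI (_ : _ @^-1` _ = [set -oo]);
    [exact: emeasurable_set1|apply/seteqP; split => x /= /eqP].
apply/measurable_EFinP; apply: measurableT_comp; first exact: measurable_expR.
exact: fine_measurable.
Qed.

Lemma cvg_expeRN (R : realType) (u : (\bar R)^nat) (l : \bar R) :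
  {homo u : m n / (m <= n)%N >-> m <= n} -> u n @[n --> \oo] --> l ->
  expeR (- u n) @[n --> \oo] --> expeR (- l).
Proof.
move=> ndu ul.
have ule n : u n <= l.
  rewrite -(cvg_lim _ ul)//; apply: lime_ge; first by apply/cvg_ex; exists l.
  by exists n => // m /= nm; exact: ndu.
have cE : cvg (expeR (- u n) @[n --> \oo]).
  by apply: ereal_nonincreasing_is_cvgn => i j ij; rewrite lee_expeR leeN2 ndu.
apply: cvg_toP => //; apply/eqP; rewrite eq_le; apply/andP; split; last first.
  by apply: lime_ge => //; apply: nearW => n; rewrite lee_expeR leeN2.
have l0 : 0 <= lim (expeR (- u n) @[n --> \oo]).
  by apply: lime_ge => //; apply: nearW => n; exact: expeR_ge0.
(* The limit is itself an exponential, so the claim becomes a comparison of exponents, infinite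
   values included. *)
have [y yE] := expeR_total l0.
rewrite -yE lee_expeR leeNr -(cvg_lim _ ul)//.
apply: lime_le; first by apply/cvg_ex; exists l.
apply: nearW => n; rewrite leeNr -lee_expeR yE.
apply: lime_le => //; exists n => // m /= nm.
by rewrite lee_expeR leeN2 ndu.
Qed.

Lemma le_measure_integral d (T : measurableType d) (R : realType)
    (m1 m2 : {measure set T -> \bar R}) : (forall A, measurable A -> m1 A <= m2 A) ->
  forall f, measurable_fun setT f -> (forall x, 0 <= f x) ->
  \int[m1]_x f x <= \int[m2]_x f x.
Proof.
move=> m12; apply: ge0_fun_ind.
- by move=> A mA; rewrite !integral_indic// setIT; exact: m12.
- by move=> f g mf mg f0 g0 If Ig; rewrite !ge0_integralD//; exact: leeD.
- by move=> c f c0 mf f0 If; rewrite !ge0_integralZl//; rewrite lee_wpmul2l.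
- move=> f mf f0 ndf If; rewrite !monotone_convergence//.
  have cvgI (m : {measure set T -> \bar R}) : cvgn (fun n => \int[m]_x f n x).
    apply: ereal_nondecreasing_is_cvgn => i j ij; apply: ge0_le_integral => //.
    by move=> x _; exact: ndf.
  by apply: lee_lim => //; exact: nearW.
Qed.

Lemma integral_probability_cst d (T : measurableType d) (R : realType)
    (P : probability T R) (c : \bar R) : \int[P]__ c = c.
Proof.
rewrite integral_cst//; transitivity (c * 1); last by rewrite mule1.
by congr (_ * _); exact: probability_setT.
Qed.

Section functional.
Context d (T : measurableType d) (R : realType) (I : (T -> \bar R) -> \bar R).
Hypothesis I_ge0 : forall f, (forall x, 0 <= f x) -> 0 <= I f.
Hypothesis I_D : forall f g, measurable_fun setT f -> measurable_fun setT g ->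
  (forall x, 0 <= f x) -> (forall x, 0 <= g x) -> I (f \+ g) = I f + I g.
Hypothesis I_Z : forall (c : R) f, (0 <= c)%R -> measurable_fun setT f ->
  (forall x, 0 <= f x) -> I (fun x => c%:E * f x) = c%:E * I f.
Hypothesis I_lim : forall f_ : (T -> \bar R)^nat, (forall n, measurable_fun setT (f_ n)) ->
  (forall n x, 0 <= f_ n x) -> (forall x, {homo f_ ^~ x : m n / (m <= n)%N >-> m <= n}) ->
  I (fun x => limn (f_ ^~ x)) = limn (fun n => I (f_ n)).

(** A Daniell-type representation, the measure being read off on indicators. It serves to turn the
    left-hand side of GNZ into a measure on pairs. *)
Lemma functional_measure : exists m : {measure set T -> \bar R},
  forall f, measurable_fun setT f -> (forall x, 0 <= f x) -> \int[m]_x f x = I f.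
Proof.
pose i (A : set T) x : \bar R := (\1_A x)%:E.
have mi A : measurable A -> measurable_fun setT (i A).
  by move=> mA; apply/measurable_EFinP; exact: measurable_indic.
have i0 A x : 0 <= i A x by rewrite lee_fin.
pose m A := I (i A).
have m0 : m set0 = 0.
  rewrite /m (_ : i set0 = fun x => 0%:E * i set0 x).
    by rewrite I_Z ?mul0e//; exact: mi.
  by apply/funext => x; rewrite /i indic0 mul0e.
have mge0 A : 0 <= m A by exact: I_ge0.
have msig : semi_sigma_additive m.
  move=> F mF tF mUF.
  have SE n : \sum_(0 <= k < n) m (F k) = I (fun x => \sum_(0 <= k < n) i (F k) x).
    elim: n => [|n ih].
      by rewrite big_nil -m0; congr (I _); apply/funext => x; rewrite big_nil /i indic0.
    rewrite big_nat_recr//= ih -I_D.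
    - by congr (I _); apply/funext => x; rewrite big_nat_recr.
    - by apply: emeasurable_sum => k; exact: mi.
    - exact: mi.
    - by move=> x; apply: sume_ge0.
    - by [].
  have -> : m (\bigcup_n F n) = limn (fun n => \sum_(0 <= k < n) m (F k)).
    rewrite /m (_ : i _ = fun x => limn (fun n => \sum_(0 <= k < n) i (F k) x)).
      rewrite I_lim.
      - by congr (limn _); apply/funext => n; rewrite SE.
      - by move=> n; apply: emeasurable_sum => k; exact: mi.
      - by move=> n x; apply: sume_ge0.
      - by move=> x a b ab; apply: lee_sum_nneg_natr => // k _ _.
    by apply/funext => x; rewrite /i indic_bigcup.
  by apply: is_cvg_nneseries.
pose mm : {measure set T -> \bar R} := HB.pack_for (measure T R) m
  (isMeasure.Build d T R m m0 mge0 msig).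
exists mm; apply: ge0_fun_ind.
- by move=> A mA; rewrite integral_indic// setIT.
- by move=> f g mf mg f0 g0 If Ig; rewrite ge0_integralD// If Ig I_D.
- by move=> c f c0 mf f0 If; rewrite ge0_integralZl// If I_Z.
- move=> f mf f0 ndf If; rewrite monotone_convergence//.
  by rewrite I_lim//; congr (limn _); apply/funext => n; exact: If.
Qed.

End functional.

Section sigma_finite.
Context d (T : measurableType d) (R : realType) (m : {measure set T -> \bar R}).
Hypothesis mfin : sigma_finite setT m.
Let sm : set T -> \bar R := m.
HB.instance Definition _ := Measure.on sm.
HB.instance Definition _ := @Measure_isSigmaFinite.Build d T R sm mfin.
Definition sigma_finite_of : {sigma_finite_measure set T -> \bar R} := sm.
End sigma_finite.

Section gibbs.
Context d (X : measurableType d) (R : realType) (dist : X -> X -> R).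
Notation N := (cmeasure dist).
Variable La : nat -> set X.
Hypothesis La_b : forall k, Xb dist (La k).
Hypothesis La_nd : forall i j, (i <= j)%N -> La i `<=` La j.
Hypothesis La_cover : \bigcup_k La k = setT.
Hypothesis La0 : La 0%N = set0.
Hypothesis La_bdd : forall B, Xb dist B -> exists k, B `<=` La k.
Variable lz : {measure set X -> \bar R}.
Hypothesis lz_fin : forall k, lz (La k) < +oo.

Let mLa := measurable_La La_b.

Let lz_sigma : sigma_finite setT lz.
Proof. by exists La. Qed.

Let lzs := sigma_finite_of lz_sigma.

Let restr_fin D (mD : measurable D) : lz D < +oo -> mrestr lz mD setT < +oo.
Proof. by rewrite /mrestr setTI. Qed.

(** * Limits of the local marginals *)

Section limit_process.
Variable Pn : nat -> probability N R.
Hypothesis Pn_sub : forall n F, measurable_fun setT F -> (forall p, 0 <= F p) ->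
  \int[Pn n]_eta \int[cm eta]_x F (x, eta) <=
  \int[lz]_x \int[Pn n]_eta F (x, cm_add_dirac eta x).
Context (U : set_system nat) {UU : UltraFilter U}.

Let P_pr0 n k := image_measure (Pn n) (measurable_pr La_b k).

Let P_pr0T n k : P_pr0 n k setT = 1. Proof. by rewrite /= preimage_setT probability_setT. Qed.

Let P_pr0_lty n k : P_pr0 n k setT < +oo. Proof. by rewrite P_pr0T ltry. Qed.

Let P_pr n k : {finite_measure set N -> \bar R} := finite_of (P_pr0_lty n k).

Let lzLa k : mrestr lz (mLa k) setT < +oo. Proof. exact: restr_fin. Qed.

Let lzce k : mrestr lz (measurable_cell La_b k) setT < +oo.
Proof.
apply: restr_fin; apply: le_lt_trans (lz_fin k.+1).
by apply: le_measurable => //; [exact: measurable_cell|exact: subDsetl].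
Qed.

Let M k := poisson dist (finite_of (lzLa k)).
Let nu k := poisson dist (finite_of (lzce k)).

Let P_pr_le n k A : measurable A -> P_pr n k A <= M k A.
Proof.
move=> mA; have D0 : La k `&` set0 = set0 by rewrite setI0.
have mi : measurable_fun setT (fun q : N * N => (\1_A q.2)%:E : \bar R).
  by apply/measurable_EFinP; apply: measurableT_comp => //; exact: measurable_indic.
have i0 (q : N * N) : 0 <= (\1_A q.2)%:E :> \bar R by rewrite lee_fin.
have h := domination La_b La_nd La_cover (@Pn_sub n) (La_b k) measurable0 D0
  (lzLa k) mi i0.
have m1A : measurable_fun setT (fun xi : N => (\1_A xi)%:E : \bar R).
  by apply/measurable_EFinP; exact: measurable_indic.
have <- : \int[M k]_zeta \int[Pn n]_eta (\1_A zeta)%:E = M k A.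
  by under eq_integral do rewrite integral_probability_cst; rewrite integral_indic// setIT.
apply: le_trans h; rewrite -[X in P_pr n k X]setIT -integral_indic//.
rewrite (@integral_image _ _ _ _ _ (Pn n) _ (measurable_pr La_b k) _ m1A).
  exact: lexx.
by move=> xi; rewrite lee_fin.
Qed.

Let both k (eta : N) := (pr La_b k eta, cpr La_b k eta).

Let mboth k : measurable_fun setT (both k).
Proof. by apply: measurable_fun_pair; [exact: measurable_pr|exact: measurable_cpr]. Qed.

Let Q_pr n k := image_measure (Pn n) (mboth k).

(** Here [domination] is used with the cell as [C] and the window [La k] as [D]. *)
Let Q_pr_le n k A : measurable A -> Q_pr n k A <= (P_pr n k \x nu k) A.
Proof.
move=> mA; have D0 : cell La k `&` La k = set0 by rewrite setIC setDIK.
have mi : measurable_fun setT (fun q : N * N => (\1_A q)%:E : \bar R).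
  by apply/measurable_EFinP; exact: measurable_indic.
have i0 (q : N * N) : 0 <= (\1_A q)%:E :> \bar R by rewrite lee_fin.
have cb : Xb dist (cell La k).
  have [_ [r rb]] := La_b k.+1; split; first exact: measurable_cell.
  by exists r => x y [? _] [? _]; exact: rb.
have := domination La_b La_nd La_cover (@Pn_sub n) cb (mLa k) D0
  (lzce k) mi i0.
rewrite -[X in X <= _]/(\int[Pn n]_eta (\1_A (both k eta))%:E).
rewrite -(integral_image _ (mboth k) mi i0) integral_indic// setIT => h.
apply: le_trans h _.
rewrite -[X in (P_pr n k \x nu k) X]setIT.
rewrite -(@integral_indic _ _ R (P_pr n k \x nu k) setT measurableT A mA).
rewrite (@fubini_tonelli2 _ _ _ _ _ (P_pr n k) (nu k) _ mi i0).
rewrite le_eqVlt; apply/orP; left; apply/eqP; apply: eq_integral => zeta _.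
apply/esym; apply: (@integral_image _ _ _ _ _ (Pn n) _ (measurable_pr La_b k)
  (fun xi => (\1_A (xi, zeta))%:E)) => [|xi].
  have mp : measurable_fun setT (fun xi : N => (xi, zeta)) by exact: measurable_fun_pair.
  exact: (measurableT_comp mi mp).
exact: i0.
Qed.

Let MfinT k : M k setT < +oo.
Proof. by move: (fin_num_measure (M k) _ measurableT); rewrite ge0_fin_numE. Qed.

Let MnufinT k : (M k \x nu k) setT < +oo.
Proof.
rewrite -setXTT product_measure1E// -ge0_fin_numE ?mule_ge0//.
by apply: fin_numM; [exact: (fin_num_measure (M k))|exact: (fin_num_measure (nu k))].
Qed.

Let prod_le k n A : measurable A -> (P_pr n k \x nu k) A <= (M k \x nu k) A.
Proof.
move=> mA; rewrite /product_measure1.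
have ms : measurable_fun setT (nu k \o xsection A) by exact: measurable_fun_xsection.
by apply: le_measure_integral => [B mB||x]; [exact: P_pr_le|exact: ms|exact: measure_ge0].
Qed.

(** The bound on the joint laws has a right-hand side that moves with [n]. Its limit [S k] exists by
    the domination [prod_le], and rectangles identify it as the product of the limit marginal and
    the fixed [nu k]; the bound thus survives in the form needed for gluing. *)
Lemma limit_process : exists P : probability N R, forall k A, cyl La_b k A ->
  Pn n A @[n --> U] --> P A.
Proof.
have /choice[p pP] : forall k, exists m : {measure set N -> \bar R},
    forall A, measurable A -> P_pr n k A @[n --> U] --> m A.
  by move=> k; apply: (limit_measure (MfinT k)) => n A; exact: P_pr_le.
have /choice[Q QP] : forall k, exists m : {measure set (N * N) -> \bar R},
    forall A, measurable A -> Q_pr n k A @[n --> U] --> m A.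
  move=> k; apply: (limit_measure (MnufinT k)) => n A mA.
  exact: le_trans (Q_pr_le _ _ mA) (prod_le _ _ mA).
have /choice[S SP] : forall k, exists m : {measure set (N * N) -> \bar R},
    forall A, measurable A -> (P_pr n k \x nu k) A @[n --> U] --> m A.
  by move=> k; apply: (limit_measure (MnufinT k)) => n A mA; exact: prod_le.
have pT k : p k setT = 1.
  rewrite -(cvg_lim _ (pP k _ measurableT))//.
  rewrite (_ : (fun n => _) = cst 1); first exact: lim_cst.
  by apply/funext => n; exact: P_pr0T.
have pfin k : p k setT < +oo by rewrite pT ltry.
pose pf k := finite_of (pfin k).
have cyl_lim k A : cyl La_b k A -> Pn n A @[n --> U] --> p k A.
  move=> [mA hA]; rewrite (_ : (fun n => Pn n A) = fun n => P_pr n k A); first exact: pP.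
  by apply/funext => n; congr (Pn n _); apply/seteqP; split => eta Ae; apply/(hA eta).
have [||||P PE] := projective_limit (La_b := La_b) La_nd La_cover La0 La_bdd
  (p_ := pf) (nu_ := nu) (Q_ := Q).
- move=> k A mA; have -> : (pf k \x nu k) A = S k A.
    apply: product_measure_unique => // B C mB mC.
    rewrite -(cvg_lim _ (SP k _ (measurableX mB mC)))//.
    rewrite (_ : (fun n => _) = fun n => P_pr n k B * nu k C); last first.
      by apply/funext => n; exact: product_measure1E.
    apply/cvg_lim => //; apply: cvgeZr; last exact: pP.
    exact: (fin_num_measure (nu k)).
  rewrite -(cvg_lim _ (QP k _ mA))// -(cvg_lim _ (SP k _ mA))//.
  apply: lee_lim; first by apply/cvg_ex; exists (Q k A); exact: QP.
    by apply/cvg_ex; exists (S k A); exact: SP.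
  by apply: nearW => n; exact: Q_pr_le.
- move=> k A mA; have mAT : measurable (A `*` (@setT N)) by exact: measurableX.
  rewrite -(cvg_lim _ (QP k _ mAT))// -(cvg_lim _ (pP k _ mA))//.
  have -> // : (fun n => Q_pr n k (A `*` setT)) = (fun n => P_pr n k A).
  apply/funext => n; congr (Pn n _).
  by apply/seteqP; split => eta //= -[].
- move=> k A mA.
  have mgA : measurable (cm_glue La_b k @^-1` A).
    by rewrite -[X in measurable X]setTI; exact: measurable_glue.
  rewrite -(cvg_lim _ (QP k _ mgA))// -(cvg_lim _ (pP k.+1 _ mA))//.
  have -> // : (fun n => P_pr n k.+1 A) = (fun n => Q_pr n k (cm_glue La_b k @^-1` A)).
  apply/funext => n; congr (Pn n _).
  apply/seteqP; split => eta /=; apply: eqm_measurable => //.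
    by apply: eqm_sym; exact: glue_pr.
  exact: glue_pr.
- exact: pT.
- by exists P => k A kA; rewrite (PE k)//; exact: cyl_lim.
Qed.

End limit_process.
Lemma measurable_Wpot (v : X -> X -> \bar R) :
  measurable_fun setT (fun p : X * X => v p.1 p.2) ->
  measurable_fun setT (fun p : X * N => Wpot v p.1 p.2).
Proof.
move=> mv.
have m1 : measurable_fun setT (fun q : (X * N) * X => (q.1.1, q.2)).
  apply: measurable_fun_pair => //.
  exact: (measurableT_comp measurable_fst measurable_fst).
have mvq : measurable_fun setT (fun q : (X * N) * X => v q.1.1 q.2).
  exact: (measurableT_comp mv m1).
have mp := measurable_integral_cm La_b La_nd La_cover measurable_snd
  (measurable_funepos mvq) (funepos_ge0 _).
have mn := measurable_integral_cm La_b La_nd La_cover measurable_snd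
  (measurable_funeneg mvq) (funeneg_ge0 _).
rewrite (_ : (fun p => _) = (fun p : X * N =>
    \int[cm p.2]_y (fun q : (X * N) * X => v q.1.1 q.2)^\+ (p, y) -
    \int[cm p.2]_y (fun q : (X * N) * X => v q.1.1 q.2)^\- (p, y))).
  exact: (emeasurable_funB mp mn).
apply/funext => p; rewrite /Wpot [LHS]integralE.
by congr (_ - _); apply: eq_integral => y _; rewrite ?funeposE ?funenegE.
Qed.

(** * Nonnegative potentials *)

Section nonnegative_potential.
Variable v : X -> X -> \bar R.
Hypothesis mv : measurable_fun setT (fun p : X * X => v p.1 p.2).
Hypothesis v0 : forall x y, 0 <= v x y.
Hypothesis v_sym : forall x y, v x y = v y x.
Hypothesis v_int : {ae lz, forall x, \int[lz]_y `|mayer v x y| < +oo}.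

Let w (p : X * N) : \bar R := expeR (- Wpot v p.1 p.2).

Let mvx x : measurable_fun setT (v x). Proof. exact: (measurable_fun_pair2 x mv). Qed.

Let Wpot0 x (eta : N) : 0 <= Wpot v x eta.
Proof. by apply: integral_ge0 => y _; exact: v0. Qed.

Let mw : measurable_fun setT w.
Proof.
apply: (measurableT_comp (@measurable_expeR R)).
under eq_fun do rewrite -sub0e; apply: emeasurable_funB => //; exact: measurable_Wpot.
Qed.

Let expeRN01 (t : \bar R) : 0 <= t -> 0 <= expeR (- t) <= 1.
Proof.
by move=> t0; rewrite expeR_ge0/= -expeR0 lee_expeR oppe_le0.
Qed.

Let w01 p : 0 <= w p <= 1. Proof. exact: expeRN01. Qed.
Let w0 p : 0 <= w p. Proof. by have /andP[] := w01 p. Qed.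
Let w1 p : w p <= 1. Proof. by have /andP[] := w01 p. Qed.

Let e x y := expeR (- v x y).
Let e0 x y : 0 <= e x y. Proof. exact: expeR_ge0. Qed.
Let e1 x y : e x y <= 1. Proof. by have /andP[] := expeRN01 (v0 x y). Qed.

Let efin x y : e x y \is a fin_num.
Proof. by rewrite ge0_fin_numE// (le_lt_trans (e1 x y))// ltry. Qed.

Let w_add x y eta : w (x, cm_add_dirac eta y) = w (x, eta) * e x y.
Proof.
rewrite /w/= /Wpot integral_cm_add_dirac// -expeRD oppeD//.
by rewrite ge0_adde_def// inE; [exact: integral_ge0|exact: v0].
Qed.

Let w_sym x y eta :
  w (x, cm_add_dirac eta y) * w (y, eta) = w (y, cm_add_dirac eta x) * w (x, eta).
Proof. by rewrite !w_add /e v_sym muleAC [RHS]muleAC (muleC (w (x, eta))). Qed.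

(** The absolute value of the Mayer function, kept only for [y] outside [La l]. *)
Let g l x y := (\1_(~` La l) y)%:E * (1 - e x y).

Let g0 l x y : 0 <= g l x y.
Proof. by rewrite /g mule_ge0 ?lee_fin// sube_ge0// efin. Qed.

Let mg l : measurable_fun setT (fun p : X * X => g l p.1 p.2).
Proof.
apply: emeasurable_funM.
  apply/measurable_EFinP; apply: measurableT_comp => //; apply: measurable_indic.
  exact: measurableC.
apply: emeasurable_funB => //; apply: (measurableT_comp (@measurable_expeR R)).
under eq_fun do rewrite -sub0e; exact: emeasurable_funB.
Qed.

Let mgx l x : measurable_fun setT (g l x).
Proof. exact: (measurable_fun_pair2 x (mg l)). Qed.

(* Truncating the interaction of [x] to [La l] costs at most the sum of [1 - e^(-v(x,y))]
   over the points [y] outside; this holds for finite configurations by adding one point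
   at a time, which is why it is stated as membership in a set of configurations. *)
Let S l x := [set eta : N | w (x, pr La_b l eta) <= w (x, eta) + \int[cm eta]_y g l x y].

Let mwp l x : measurable_fun setT (fun eta : N => w (x, pr La_b l eta)).
Proof. exact: (measurableT_comp (measurable_fun_pair2 x mw) (measurable_pr La_b l)). Qed.

Let mtail l x : measurable_fun setT (fun eta : N => \int[cm eta]_y g l x y).
Proof.
apply: (measurable_integral_cm La_b La_nd La_cover (g := id)
  (F := fun q : N * X => g l x q.2)) => //.
  exact: (measurableT_comp (mgx l x) measurable_snd).
Qed.

Let mS l x : measurable (S l x).
Proof.
rewrite -[S l x]setTI; apply: measurable_lee => //; apply: emeasurable_funD => //.
exact: (measurable_fun_pair2 x mw).
Qed.

Let S0 l x : S l x (cm0 dist).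
Proof.
rewrite /S/= (integral_cm0 dist (g l x)) adde0 lee_expeR leeN2.
by rewrite [leLHS]integral_cm0; exact: Wpot0.
Qed.

(** A point inside [La l] multiplies both Boltzmann factors by [e x y]. A point outside leaves the
    truncated factor alone and lowers the full one by at most [1 - e x y], the new term of the
    sum. *)
Let S_add l x eta y : S l x eta -> S l x (cm_add_dirac eta y).
Proof.
rewrite /S/= w_add integral_cm_add_dirac//.
set a := w (x, pr La_b l eta); set b := w (x, eta); set t := \int[_]_y _ => abt.
have t0 : 0 <= t by apply: integral_ge0 => z _; exact: g0.
have [yl|yl] := pselect (La l y).
- have -> : w (x, pr La_b l (cm_add_dirac eta y)) = a * e x y.
    transitivity (w (x, cm_add_dirac (pr La_b l eta) y)); last exact: w_add.
    apply: (@eqm_measurable_fun2 _ _ _ _ w x _ _ mw) => B mB.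
    rewrite cm_add_diracE /pr !cm_restrE cm_add_diracE; congr (_ + _).
    by rewrite !diracE in_setI (mem_set yl) andbT.
  have -> : g l x y = 0 by rewrite /g indicE memNset ?mul0e//; exact.
  rewrite adde0; apply: (le_trans (lee_wpmul2r (e0 x y) abt)).
  have -> : (b + t) * e x y = b * e x y + t * e x y.
    by apply: ge0_muleDl => //; exact: w0.
  by apply: leeD2l; rewrite -[leRHS]mule1; exact: lee_wpmul2l.
- have -> : w (x, pr La_b l (cm_add_dirac eta y)) = a.
    apply: (@eqm_measurable_fun2 _ _ _ _ w x _ _ mw) => B mB.
    rewrite /pr !cm_restrE cm_add_diracE diracE memNset ?adde0//.
    by move=> [_ /yl].
  have -> : g l x y = 1 - e x y by rewrite /g indicE mem_set ?mul1e.
  apply: (le_trans abt).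
  have -> : b * e x y + (t + (1 - e x y)) = t + (b * e x y + (1 - e x y)) by exact: addeCA.
  have -> : b + t = t + b by exact: addeC.
  apply: leeD2l.
  have b0 : 0 <= b by exact: w0.
  have b1 : b <= 1 by exact: w1.
  have bfin : b \is a fin_num by rewrite ge0_fin_numE// (le_lt_trans b1)// ltry.
  move: (e1 x y) b1 b0.
  rewrite -(fineK (efin x y)) -(fineK bfin) -EFinM -EFinB -EFinD !lee_fin => ex1 b1 b0.
  (* This is (1 - b)(1 - e x y) >= 0. *)
  nra.
Qed.

(** * Passage to the limit in the GNZ equation *)

Section thermodynamic_limit.
Variable Pn : nat -> probability N R.
Hypothesis Pn_gnz : forall n F, measurable_fun setT F -> (forall p, 0 <= F p) ->
  \int[Pn n]_eta \int[cm eta]_x F (x, eta) =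
  \int[mrestr lz (mLa n)]_x \int[Pn n]_eta (F (x, cm_add_dirac eta x) * w (x, eta)).
Hypothesis Pn_closed : forall n (B : set N), measurable B -> B (cm0 dist) ->
  (forall eta x, B eta -> B (cm_add_dirac eta x)) -> Pn n (~` B) = 0.

Let madd : measurable_fun setT (fun p : X * N => cm_add_dirac p.2 p.1).
Proof. exact: measurable_cm_add_dirac. Qed.

Let mint (P : probability N R) (F : X * N -> \bar R) : measurable_fun setT F ->
  (forall p, 0 <= F p) -> measurable_fun setT (fun x => \int[P]_eta F (x, eta)).
Proof. by move=> mF F0; exact: (@measurable_fun_fubini_tonelli_F _ _ _ _ R P _ mF). Qed.

(** The weight is at most 1 and the window is part of the space. The right-hand side no longer
    refers to the window, which is the source of all uniformity in [n]. *)
Lemma Pn_sub n F : measurable_fun setT F -> (forall p, 0 <= F p) ->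
  \int[Pn n]_eta \int[cm eta]_x F (x, eta) <=
  \int[lz]_x \int[Pn n]_eta F (x, cm_add_dirac eta x).
Proof.
move=> mF F0; rewrite Pn_gnz//.
have mFa : measurable_fun setT (fun p : X * N => F (p.1, cm_add_dirac p.2 p.1)).
  exact: measurable_comp2.
have mFw : measurable_fun setT (fun p : X * N => F (p.1, cm_add_dirac p.2 p.1) * w p).
  exact: emeasurable_funM.
apply: (@le_trans _ _ (\int[mrestr lz (mLa n)]_x \int[Pn n]_eta F (x, cm_add_dirac eta x))).
  apply: ge0_le_integral => //.
  - by move=> x _; apply: integral_ge0 => eta _; rewrite mule_ge0.
  - by apply: (mint (Pn n) mFw) => p; rewrite mule_ge0.
  - by apply: (mint (Pn n) mFa) => p.
  - move=> x _; apply: ge0_le_integral => //.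
    + by move=> eta _; rewrite mule_ge0.
    + exact: (measurable_fun_pair2 x mFw).
    + exact: (measurable_fun_pair2 x mFa).
    + by move=> eta _; rewrite -[leRHS]mule1 lee_wpmul2l.
apply: le_measure_integral => [A mA||x].
- by apply: le_measurable => //; exact: measurableI.
- by apply: (mint (Pn n) mFa) => p.
- exact: integral_ge0.
Qed.

Let r l x := \int[lz]_y g l x y.

Let r0 l x : 0 <= r l x. Proof. by apply: integral_ge0 => y _; exact: g0. Qed.

Let mr l : measurable_fun setT (r l).
Proof. by apply: (@measurable_fun_fubini_tonelli_F _ _ _ _ R lzs _ (mg l)) => p; exact: g0. Qed.

Lemma tail_bound n l x : \int[Pn n]_eta \int[cm eta]_y g l x y <= r l x.
Proof.
have mF : measurable_fun setT (fun p : X * N => g l x p.1).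
  exact: (measurableT_comp (mgx l x) measurable_fst).
apply: le_trans (Pn_sub n mF (fun p => g0 l x p.1)) _.
by under eq_integral do rewrite /= integral_probability_cst.
Qed.

Section test_sets.
Variables (D : set X) (A : set N) (j k : nat) (b : R).
Hypotheses (mD : measurable D) (Dj : D `<=` La j) (cA : cyl La_b k A).
Hypothesis Ab : forall eta, A eta -> eta D <= b%:E.

Let mA : measurable A. Proof. by have [] := cA. Qed.

Let lzD_lty : lz D < +oo.
Proof. by apply: le_lt_trans (lz_fin j); exact: le_measurable. Qed.

Let lzD := finite_of (restr_fin mD lzD_lty).

Let iA eta : \bar R := (\1_A eta)%:E.

Let miA : measurable_fun setT iA.
Proof. by apply/measurable_EFinP; exact: measurable_indic. Qed.

Let iA0 eta : 0 <= iA eta. Proof. by rewrite lee_fin. Qed.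

Let iA1 eta : iA eta <= 1.
Proof. by rewrite lee_fin indicE; case: (_ \in _). Qed.

Let ia (p : X * N) := iA (cm_add_dirac p.2 p.1).

Let mia : measurable_fun setT ia. Proof. exact: (measurableT_comp miA madd). Qed.

Let wl l (p : X * N) := w (p.1, pr La_b l p.2).

Let mwl l : measurable_fun setT (wl l).
Proof.
apply: (measurable_comp2 mw) => //.
exact: (measurableT_comp (measurable_pr La_b l) measurable_snd).
Qed.

Let miw : measurable_fun setT (fun p => ia p * w p).
Proof. exact: emeasurable_funM. Qed.

Let miwl l : measurable_fun setT (fun p => ia p * wl l p).
Proof. exact: emeasurable_funM. Qed.

Let iw0 p : 0 <= ia p * w p. Proof. by apply: mule_ge0; [exact: iA0|exact: w0]. Qed.
Let iwl0 l p : 0 <= ia p * wl l p.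
Proof. by apply: mule_ge0; [exact: iA0|exact: w0]. Qed.
Let iwl1 l p : ia p * wl l p <= 1.
Proof. by rewrite -[leRHS]mul1e; apply: lee_pmul; [exact: iA0|exact: w0|exact: iA1|exact: w1]. Qed.

Let w_le_wl l p : w p <= wl l p.
Proof.
rewrite /w /wl /= lee_expeR leeN2 [leLHS]integral_cm_restr//.
by apply: ge0_subset_integral => //; exact: mLa.
Qed.

(** [r l x] is only known to be finite for almost every [x], with no integrability over [D]. The
    truncated weight never exceeds 1, so the cap is harmless, and it supplies the dominating
    constant for [c_cvg]. *)
Let m1 l x := mine 1 (r l x).

Let m10 l x : 0 <= m1 l x. Proof. by rewrite /m1 le_min lee01 r0. Qed.

Let mm1 l : measurable_fun setT (m1 l).
Proof. exact: measurable_mine. Qed.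

(** [S l x] is almost sure by [Pn_closed], and its error term has mean at most [r l x]; when the cap
    is active, the bound 1 on the integrand suffices. *)
Lemma approx_tail n l x : \int[Pn n]_eta (ia (x, eta) * wl l (x, eta)) <=
  \int[Pn n]_eta (ia (x, eta) * w (x, eta)) + m1 l x.
Proof.
have mx := measurable_fun_pair2 x miw; have mlx := measurable_fun_pair2 x (miwl l).
have i0 : 0 <= \int[Pn n]_eta (ia (x, eta) * w (x, eta)).
  by apply: integral_ge0 => eta _; exact: iw0.
rewrite /m1 /mine; case: ifPn => _.
  rewrite -[leLHS]add0e leeD// -[leRHS](integral_probability_cst (Pn n)).
  exact: ge0_le_integral.
apply: (@le_trans _ _ (\int[Pn n]_eta (ia (x, eta) * w (x, eta) + \int[cm eta]_y g l x y))).
  apply: ae_ge0_le_integral => //.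
  - by move=> eta _; apply: adde_ge0; [exact: iw0|apply: integral_ge0 => y _; exact: g0].
  - by apply: emeasurable_funD => //; exact: mtail.
  - exists (~` S l x); split.
    + by apply: measurableC; exact: mS.
    + by apply: Pn_closed; [exact: mS|exact: S0|move=> eta y; exact: S_add].
    + apply: subsetC => eta Se _.
      apply: (@le_trans _ _ (ia (x, eta) * (w (x, eta) + \int[cm eta]_y g l x y))).
        by apply: lee_wpmul2l; [exact: iA0|exact: Se].
      have t0 : 0 <= \int[cm eta]_y g l x y by apply: integral_ge0 => y _; exact: g0.
      have -> : ia (x, eta) * (w (x, eta) + \int[cm eta]_y g l x y) =
          ia (x, eta) * w (x, eta) + ia (x, eta) * \int[cm eta]_y g l x y.
        by apply: ge0_muleDr; [exact: w0|exact: t0].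
      by apply: leeD2l; rewrite -[leRHS]mul1e; apply: lee_wpmul2r => //; exact: iA1.
rewrite ge0_integralD//.
- by rewrite leeD2l//; exact: tail_bound.
- by move=> eta _; apply: integral_ge0 => y _; exact: g0.
Qed.

Variable P : probability N R.
Context (U : set_system nat) {UU : UltraFilter U}.
Hypothesis HU : \oo `<=` U.
Hypothesis HP : forall k A, cyl La_b k A -> Pn n A @[n --> U] --> P A.

(** [f] factors through [pr i], whose laws converge setwise because preimages under [pr i] are
    cylinders. *)
Lemma cvg_cyl (f : N -> \bar R) i (c : R) : measurable_fun setT f ->
  (forall eta, 0 <= f eta <= c%:E) -> (forall eta, f eta = f (pr La_b i eta)) ->
  \int[Pn n]_eta f eta @[n --> U] --> \int[P]_eta f eta.
Proof.
move=> mf fc fpr; have f0 eta : 0 <= f eta by have /andP[] := fc eta.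
have E (Q : probability N R) :
    \int[Q]_eta f eta = \int[image_measure Q (measurable_pr La_b i)]_eta f eta.
  by rewrite integral_image//; apply: eq_integral => eta _; exact: fpr.
rewrite E (_ : (fun n => _) = (fun n =>
    \int[image_measure (Pn n) (measurable_pr La_b i)]_eta f eta)); last first.
  by apply/funext => n; exact: E.
apply: (@cvg_integral _ _ _ _ _ _ _ 1%R _ _ f c) => //.
  by move=> n; rewrite /= preimage_setT probability_setT.
by move=> B mB; apply: (HP (k := i)); exact: cyl_preimage.
Qed.

Let a n := \int[Pn n]_eta (iA eta * eta D).
Let al := \int[P]_eta (iA eta * eta D).

Let mD_eval : measurable_fun setT (fun eta : N => iA eta * eta D).
Proof. by apply: emeasurable_funM => //; exact: measurable_eval. Qed.

Let a_cvg : a n @[n --> U] --> al.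
Proof.
apply: (@cvg_cyl _ (maxn k j) (Num.max b 0%R)) => //.
- move=> eta; rewrite mule_ge0//= /iA indicE.
  case: (boolP (_ \in _)) => [/set_mem/Ab h|_]; last by rewrite mul0e lee_fin le_max lexx orbT.
  by rewrite mul1e (le_trans h)// lee_fin le_max lexx.
- move=> eta; congr (_ * _).
    have [_ h] := cyl_le La_nd (leq_maxl k j) cA.
    by rewrite /iA !indicE; congr ((nat_of_bool _)%:R%:E); apply/idP/idP => /set_mem x;
      apply/mem_set; [exact: (h eta).1|exact: (h eta).2].
  rewrite /pr cm_restrE (_ : D `&` _ = D)//; apply/setIidPl.
  by apply: subset_trans Dj _; apply: La_nd; exact: leq_maxr.
Qed.

Let a_gnz n : (j <= n)%N -> a n = \int[lzD]_x \int[Pn n]_eta (ia (x, eta) * w (x, eta)).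
Proof.
move=> jn; pose F (p : X * N) := (\1_D p.1)%:E * iA p.2.
have mi : measurable_fun setT (fun x => (\1_D x)%:E : \bar R).
  by apply/measurable_EFinP; exact: measurable_indic.
have mF : measurable_fun setT F.
  apply: emeasurable_funM; first exact: (measurableT_comp mi measurable_fst).
  exact: (measurableT_comp miA measurable_snd).
have F0 p : 0 <= F p by apply: mule_ge0; [rewrite lee_fin|exact: iA0].
have -> : a n = \int[Pn n]_eta \int[cm eta]_x F (x, eta).
  apply: eq_integral => eta _; rewrite /F/= ge0_integralZr//.
  - by rewrite integral_indic// setIT muleC.
rewrite (Pn_gnz n mF F0).
pose h x := \int[Pn n]_eta (ia (x, eta) * w (x, eta)).
have mh : measurable_fun setT h by exact: (mint (Pn n) miw).
have h0 x : 0 <= h x by exact: integral_ge0.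
have E x : \int[Pn n]_eta (F (x, cm_add_dirac eta x) * w (x, eta)) = (\1_D x)%:E * h x.
  rewrite /h -ge0_integralZl//; last exact: (measurable_fun_pair2 x miw).
  by apply: eq_integral => eta _; rewrite /F/= muleA.
under eq_integral do rewrite E.
transitivity (\int[lz]_(x in D) h x); last by apply/esym; exact: (integral_restr lz mD mh h0).
rewrite integral_restr; last 2 first.
- exact: emeasurable_funM.
- by move=> x; rewrite mule_ge0// lee_fin.
rewrite [LHS]integral_mkcond [RHS]integral_mkcond; apply: eq_integral => x _.
rewrite !patchE indicE; case: ifPn => xn; case: ifPn => xD; rewrite ?mul1e ?mul0e//.
by move/negP : xn; case; apply/mem_set; apply: (La_nd jn); apply: Dj; exact/set_mem.
Qed.

(* The right-hand side of GNZ with the truncated weight is the integral of a local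
   function, hence converges along [U]; [c l] bounds the truncation error for all [n]. *)
Let bb (Q : probability N R) l := \int[lzD]_x \int[Q]_eta (ia (x, eta) * wl l (x, eta)).
Let c l := \int[lzD]_x m1 l x.

Let b_le n l : (j <= n)%N -> bb (Pn n) l <= a n + c l.
Proof.
move=> jn; rewrite (a_gnz jn) /c.
have mh := mint (Pn n) miw iw0.
have h0 x : 0 <= \int[Pn n]_eta (ia (x, eta) * w (x, eta)).
  by apply: integral_ge0 => eta _; exact: iw0.
rewrite -(ge0_integralD lzD measurableT (fun x _ => h0 x) mh (fun x _ => m10 l x) (mm1 l)).
apply: ge0_le_integral; first exact: measurableT.
- by move=> x _; apply: integral_ge0 => eta _; exact: iwl0.
- exact: (mint (Pn n) (miwl l) (iwl0 l)).
- exact: (emeasurable_funD mh (mm1 l)).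
- by move=> x _; exact: approx_tail.
Qed.

Let a_le n l : (j <= n)%N -> a n <= bb (Pn n) l.
Proof.
move=> jn; rewrite (a_gnz jn); apply: ge0_le_integral; first exact: measurableT.
- by move=> x _; apply: integral_ge0 => eta _; exact: iw0.
- exact: (mint (Pn n) miw iw0).
- exact: (mint (Pn n) (miwl l) (iwl0 l)).
- move=> x _; apply: ge0_le_integral; first exact: measurableT.
  + by move=> eta _; exact: iw0.
  + exact: (measurable_fun_pair2 x miw).
  + exact: (measurable_fun_pair2 x (miwl l)).
  + by move=> eta _; apply: lee_wpmul2l; [exact: iA0|exact: w_le_wl].
Qed.

Let swap (Q : probability N R) l :
  bb Q l = \int[Q]_eta \int[lzD]_x (ia (x, eta) * wl l (x, eta)).
Proof. exact: (@fubini_tonelli _ _ _ _ R lzD Q _ (miwl l) (iwl0 l)). Qed.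

(** After Fubini the inner integral is a bounded function of the configuration in [La (maxn k l)]:
    level [k] serves the event [A], level [l] the truncated weight. *)
Let b_cvg l : bb (Pn n) l @[n --> U] --> bb P l.
Proof.
pose f eta := \int[lzD]_x (ia (x, eta) * wl l (x, eta)).
rewrite swap (_ : (fun n => _) = fun n => \int[Pn n]_eta f eta); last first.
  by apply/funext => n; exact: swap.
have lzDfin : lzD setT \is a fin_num by exact: (fin_num_measure lzD).
apply: (@cvg_cyl f (maxn k l) (fine (lzD setT))).
- exact: (@measurable_fun_fubini_tonelli_G _ _ _ _ R lzD _ (miwl l) (iwl0 l)).
- move=> eta; rewrite integral_ge0//= fineK//.
  rewrite -[leRHS]mul1e -integral_cst//; apply: ge0_le_integral => //.
    exact: (measurable_fun_pair1 eta (miwl l)).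
- move=> eta; apply: eq_integral => x _; congr (_ * _).
    have [_ h] := cA.
    have eqk : eqm (pr La_b k (cm_add_dirac eta x))
        (pr La_b k (cm_add_dirac (pr La_b (maxn k l) eta) x)).
      move=> B mB; rewrite /pr !cm_restrE !cm_add_diracE !cm_restrE; congr (_ + _).
      rewrite -setIA (_ : La k `&` _ = La k)//; apply/setIidPl.
      by apply: La_nd; exact: leq_maxl.
    rewrite /ia/= /iA !indicE; congr ((nat_of_bool _)%:R%:E).
    apply/idP/idP => /set_mem/(h _) hh; apply/mem_set/(h _).
      exact: (eqm_measurable mA eqk).
    exact: (eqm_measurable mA (eqm_sym eqk)).
  rewrite /wl/=; apply: (@eqm_measurable_fun2 _ _ _ _ w x _ _ mw); apply: eqm_sym.
  by apply: pr_pr => //; exact: leq_maxr.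
Qed.

Let al_le l : al <= bb P l.
Proof.
rewrite -(cvg_lim _ a_cvg)// -(cvg_lim _ (@b_cvg l))//; apply: lee_lim.
- by apply/cvg_ex; exists al.
- by apply/cvg_ex; exists (bb P l); exact: b_cvg.
- by apply: HU; exists j => // n /= jn; exact: a_le.
Qed.

Let bb_le l : bb P l <= al + c l.
Proof.
have cfin : c l \is a fin_num.
  rewrite ge0_fin_numE; last by apply: integral_ge0 => x _; exact: m10.
  apply: (@le_lt_trans _ _ (lzD setT)); last by rewrite -ge0_fin_numE// (fin_num_measure lzD).
  rewrite -[leRHS]mul1e -integral_cst//; apply: ge0_le_integral => //.
  by move=> x _; rewrite /m1 ge_min lexx.
have cv : a n + c l @[n --> U] --> al + c l.
  by apply: cvgeD; [rewrite fin_num_adde_defl|exact: a_cvg|exact: cvg_cst].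
rewrite -(cvg_lim _ cv)// -(cvg_lim _ (@b_cvg l))//; apply: lee_lim.
- by apply/cvg_ex; exists (bb P l); exact: b_cvg.
- by apply/cvg_ex; exists (al + c l).
- by apply: HU; exists j => // n /= jn; exact: b_le.
Qed.

Let mayerE x y : `|mayer v x y| = 1 - e x y.
Proof.
rewrite /mayer -/(e x y); move: (e1 x y); rewrite -(fineK (efin x y)) lee_fin => h.
by rewrite -EFinB /abse ler0_norm ?subr_le0// opprB EFinB.
Qed.

Let r_cvg x : \int[lz]_y `|mayer v x y| < +oo -> r l x @[l --> \oo] --> 0.
Proof.
move=> vx.
have mh : measurable_fun setT (fun y => 1 - e x y).
  apply: emeasurable_funB => //; apply: (measurableT_comp (@measurable_expeR R)).
  by under eq_fun do rewrite -sub0e; exact: emeasurable_funB.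
have h0 y : 0 <= 1 - e x y by rewrite sube_ge0 ?efin.
have hint : lz.-integrable setT (fun y => 1 - e x y).
  apply/integrableP; split => //.
  by under eq_integral do rewrite gee0_abs// -mayerE.
have ae1 : {ae lz, forall y, setT y -> g l x y @[l --> \oo] --> (fun=> 0 : \bar R) y}.
  apply: aeW => y _; have [i _ iy] : (\bigcup_k La k) y by rewrite La_cover.
  apply: cvg_near_cst; exists i => // n /= ni.
  by rewrite /g indicE memNset ?mul0e//= => ny; apply: ny; exact: La_nd ni _ iy.
have ae2 : {ae lz, forall y n, setT y -> `|g n x y| <= 1 - e x y}.
  apply: aeW => y n _; rewrite gee0_abs// /g indicE.
  by case: (_ \in _); rewrite ?mul1e ?mul0e.
have [_ _] := dominated_convergence measurableT (fun l => mgx l x) (measurable_cst _) ae1 hint ae2.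
by rewrite [X in _ --> X]integral0_eq.
Qed.

Let lzD_integrable1 : lzD.-integrable setT (cst 1).
Proof.
have h : lzD.-integrable setT (cst (1%R)%:E) by exact: finite_measure_integrable_cst.
exact: h.
Qed.

Let c_cvg : c l @[l --> \oo] --> 0.
Proof.
have ae1 : {ae lzD, forall x, setT x -> m1 l x @[l --> \oo] --> (fun=> 0 : \bar R) x}.
  have [B [mB B0 vB]] := v_int; exists B; split => //.
    apply/eqP; rewrite eq_le measure_ge0 andbT -B0.
    by apply: le_measurable => //; exact: measurableI.
  apply: subset_trans vB; apply: subsetC => x /= vx _.
  apply: (@squeeze_cvge _ _ _ _ (cst 0) _ (fun l => r l x)).
  - by apply: nearW => n; rewrite m10/= /m1 ge_min lexx orbT.
  - exact: cvg_cst.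
  - exact: r_cvg.
have ae2 : {ae lzD, forall x n, setT x -> `|m1 n x| <= cst 1 x}.
  by apply: aeW => x n _; rewrite gee0_abs// /m1 ge_min lexx.
have [_ _] := dominated_convergence measurableT mm1 (measurable_cst _) ae1 lzD_integrable1 ae2.
by rewrite [X in _ --> X]integral0_eq.
Qed.

Let wl_cvg p : wl l p @[l --> \oo] --> w p.
Proof.
case: p => x eta; rewrite /wl/w/=.
have E l : Wpot v x (pr La_b l eta) = \int[cm eta]_y ((v x) \_ (La l)) y.
  by rewrite /Wpot integral_cm_restr// integral_mkcond.
have ndv y i i' : (i <= i')%N -> ((v x) \_ (La i)) y <= ((v x) \_ (La i')) y.
  move=> ii; rewrite !patchE; case: ifPn => yi; case: ifPn => yj //.
  by move/negP : yj; case; apply/mem_set; apply: (La_nd ii); exact/set_mem.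
have v0r i y : 0 <= ((v x) \_ (La i)) y by rewrite patchE; case: ifPn.
have mvr i : measurable_fun setT ((v x) \_ (La i)).
  by apply/(measurable_restrictT _ (mLa i)); exact: measurable_funTS.
apply: (@cvg_expeRN _ (fun l => Wpot v x (pr La_b l eta))).
  move=> i i' ii; rewrite !E; apply: ge0_le_integral => //.
  by move=> y _; exact: ndv.
rewrite (_ : (fun l => _) = fun l => \int[cm eta]_y ((v x) \_ (La l)) y); last first.
  by apply/funext => l; exact: E.
rewrite (_ : Wpot v x eta = \int[cm eta]_y limn (fun l => ((v x) \_ (La l)) y)).
  apply: cvg_monotone_convergence => //.
  by move=> y _ i i' ii; exact: ndv.
apply: eq_integral => y _; apply/esym/cvg_lim => //.
have [i _ iy] : (\bigcup_k La k) y by rewrite La_cover.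
apply: cvg_near_cst; exists i => // n /= ni.
by rewrite patchE mem_set//; exact: La_nd ni _ iy.
Qed.

Let be := \int[lzD]_x \int[P]_eta (ia (x, eta) * w (x, eta)).

Let bb_cvg : bb P l @[l --> \oo] --> be.
Proof.
have lty : (lzD \x P) setT < +oo.
  rewrite -setXTT product_measure1E// -ge0_fin_numE ?mule_ge0//.
  by apply: fin_numM; [exact: (fin_num_measure lzD)|exact: (fin_num_measure P)].
pose mu := finite_of lty.
have int1 : mu.-integrable setT (cst 1).
  have h : mu.-integrable setT (cst (1%R)%:E) by exact: finite_measure_integrable_cst.
  exact: h.
have E (f : X * N -> \bar R) : measurable_fun setT f -> (forall p, 0 <= f p) ->
    \int[lzD]_x \int[P]_eta f (x, eta) = \int[mu]_p f p.
  by move=> mf f0; apply/esym; exact: (@fubini_tonelli1 _ _ _ _ R lzD P f mf f0).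
rewrite /be (E _ miw iw0) (_ : (fun l => _) = fun l => \int[mu]_p (ia p * wl l p)); last first.
  by apply/funext => l; exact: (E _ (miwl l) (iwl0 l)).
have ae1 : {ae mu, forall p, setT p -> ia p * wl l p @[l --> \oo] --> ia p * w p}.
  by apply: aeW => p _; apply: cvgeZl => //; exact: wl_cvg.
have ae2 : {ae mu, forall p n, setT p -> `|ia p * wl n p| <= cst 1 p}.
  by apply: aeW => p n _; rewrite gee0_abs; [exact: iwl1|exact: iwl0].
by have [] := dominated_convergence measurableT miwl miw ae1 int1 ae2.
Qed.

(** At fixed [l] the limit along [U] has given [al <= bb P l <= al + c l]; as [l] grows, [c l]
    vanishes and [bb P l] tends to the untruncated side. *)
Lemma gnz_test : \int[P]_eta (iA eta * eta D) =
  \int[lzD]_x \int[P]_eta (ia (x, eta) * w (x, eta)).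
Proof.
apply/eqP; rewrite eq_le; apply/andP; split.
  rewrite -/al -[leRHS](cvg_lim _ bb_cvg)//; apply: lime_ge.
    by apply/cvg_ex; exists be.
  by apply: nearW => l; exact: al_le.
have cv : al + c l @[l --> \oo] --> al + 0.
  by apply: cvgeD; [rewrite fin_num_adde_defl|exact: cvg_cst|exact: c_cvg].
rewrite -/al -/be -[leRHS]adde0 -(cvg_lim _ cv)// -(cvg_lim _ bb_cvg)//; apply: lee_lim.
- by apply/cvg_ex; exists be.
- by apply/cvg_ex; exists (al + 0).
- by apply: nearW => l; exact: bb_le.
Qed.

End test_sets.

(* The bound on [eta D] over [A] makes both sides of GNZ finite on these rectangles. *)
Definition test_rect (E : set (X * N)) := exists (D : set X) (A : set N) (j k : nat) (b : R),
  [/\ E = D `*` A, measurable D, D `<=` La j, cyl La_b k A &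
      forall eta, A eta -> eta D <= b%:E].

Lemma test_rectI : setI_closed test_rect.
Proof.
move=> _ _ [D [A [j [k [b [-> mD Dj cA Ab]]]]]] [D' [A' [j' [k' [b' [-> mD' Dj' cA' Ab']]]]]].
exists (D `&` D'), (A `&` A'), j, (maxn k k'), b; split.
- by rewrite setXI.
- exact: measurableI.
- by move=> x [/Dj].
- apply: cylI.
    by apply: cyl_le cA => //; exact: leq_maxl.
  by apply: cyl_le cA' => //; exact: leq_maxr.
- move=> eta [/Ab h _]; apply: le_trans h.
  by apply: le_measurable => //; exact: measurableI.
Qed.

Let Ej j (M : nat) := [set eta : N | eta (La j) <= M%:R%:E].

Let cyl_Ej j M : cyl La_b j (Ej j M).
Proof.
have mE : measurable (Ej j M).
  rewrite -[Ej j M]setTI; apply: measurable_lee => //; exact: measurable_eval.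
by split => // eta; rewrite /Ej/= /pr cm_restrE setIid.
Qed.

Lemma test_rect_Ej D A j k M : measurable D -> D `<=` La j -> cyl La_b k A ->
  test_rect (D `*` (A `&` Ej j M)).
Proof.
move=> mD Dj cA; exists D, (A `&` Ej j M), j, (maxn k j), M%:R; split => //.
- apply: cylI; first by apply: cyl_le cA => //; exact: leq_maxl.
  by apply: cyl_le (cyl_Ej j M) => //; exact: leq_maxr.
- by move=> eta [_]; apply: le_trans; exact: le_measurable.
Qed.

Lemma La_Ej_cover : \bigcup_p (La p.1 `*` Ej p.1 p.2) = setT.
Proof.
apply/seteqP; split => // -[x eta] _.
have [j _ jx] : (\bigcup_k La k) x by rewrite La_cover.
have [n nE] := cm_int eta (La_b j).
by exists (j, n) => //; split => //=; rewrite /Ej/= nE.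
Qed.

(** For fixed [j] and [M], the events [A] whose product, cut to [La j] and [Ej j M], is generated
    form a sigma-algebra containing the cylinders; complements are taken inside the cut. Countably
    many cuts cover the space. *)
Lemma measurable_test_rect : @measurable _ (X * N)%type = <<s test_rect >>.
Proof.
apply/seteqP; split; last first.
  apply: smallest_sub; first exact: sigma_algebra_measurable.
  by move=> _ [D [A [j [k [b [-> mD _ [mA _] _]]]]]]; exact: measurableX.
rewrite measurable_prod_measurableType.
apply: smallest_sub; first exact: smallest_sigma_algebra.
move=> _ [D mD [A mA <-]].
pose T := g_sigma_algebraType test_rect.
have rectP E : test_rect E -> @measurable _ T E by exact: sub_sigma_algebra.
suff H j M : @measurable _ T ((D `&` La j) `*` (A `&` Ej j M)).
  rewrite (_ : D `*` A = \bigcup_p ((D `&` La p.1) `*` (A `&` Ej p.1 p.2))).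
    apply: (@countable_bigcupT_measurable _ T (nat * nat)%type); first exact: countableP.
    by move=> -[j M]; exact: H.
  rewrite -[D `*` A]setIT -La_Ej_cover setI_bigcupr.
  by apply: eq_bigcupr => p _; rewrite setXI.
have mDj : measurable (D `&` La j) by exact: measurableI.
have Dj : D `&` La j `<=` La j by exact: subIsetr.
move: A mA; rewrite (measurable_cylinder La_b La_nd La_cover).
apply: smallest_sub; last first.
  by move=> A [k cA]; apply: rectP; exact: test_rect_Ej cA.
split.
- by rewrite /= set0I setX0; exact: measurable0.
- move=> A /= mA; rewrite (_ : _ `*` _ = ((D `&` La j) `*` (setT `&` Ej j M)) `\`
      ((D `&` La j) `*` (A `&` Ej j M))).
    apply: measurableD => //; apply: rectP.
    exact: (test_rect_Ej _ mDj Dj (cyl_setT La_b 0%N)).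
  apply/seteqP; split => [[x eta] [/= Dx [[_ nA] Ee]]|[x eta] [[/= Dx [_ Ee]] nA]].
    by split => //= -[_ []].
  by split => //; split => //; split => // Ae; apply: nA.
- move=> F /= mF; rewrite setI_bigcupl setX_bigcupr.
  exact: bigcupT_measurable.
Qed.

(** Both sides are integrals against measures on pairs: [m1] is the Campbell measure of [P], and
    [m2] the image, under insertion of the point, of the measure with density [w]. They agree on
    [test_rect], which is stable under intersection, generates, and exhausts the space by sets of
    finite mass. *)
Lemma gnz_limit (P : probability N R) (U : set_system nat) (UU : UltraFilter U) :
  \oo `<=` U -> (forall k A, cyl La_b k A -> Pn n A @[n --> U] --> P A) ->
  forall F, measurable_fun setT F -> (forall p, 0 <= F p) ->
  \int[P]_eta \int[cm eta]_x F (x, eta) =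
  \int[lz]_x \int[P]_eta (F (x, cm_add_dirac eta x) * w (x, eta)).
Proof.
move=> HU HP.
pose I1 (F : X * N -> \bar R) := \int[P]_eta \int[cm eta]_x F (x, eta).
have mI (F : X * N -> \bar R) : measurable_fun setT F -> (forall p, 0 <= F p) ->
    measurable_fun setT (fun eta : N => \int[cm eta]_x F (x, eta)).
  by move=> mF F0; exact: (measurable_integral_id La_b La_nd La_cover).
have I0 (F : X * N -> \bar R) eta : (forall p, 0 <= F p) -> 0 <= \int[cm eta]_x F (x, eta).
  by move=> F0; exact: integral_ge0.
have [m1 m1P] : exists m : {measure set (X * N) -> \bar R},
    forall f, measurable_fun setT f -> (forall p, 0 <= f p) -> \int[m]_p f p = I1 f.
  apply: functional_measure.
  - by move=> f f0; apply: integral_ge0 => eta _; exact: I0.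
  - move=> f h mf mh f0 h0; rewrite /I1 -ge0_integralD//; last 4 first.
    + by move=> eta _; exact: I0.
    + exact: mI.
    + by move=> eta _; exact: I0.
    + exact: mI.
    apply: eq_integral => eta _; rewrite ge0_integralD//.
    + exact: (measurable_fun_pair1 eta mf).
    + exact: (measurable_fun_pair1 eta mh).
  - move=> c f c0 mf f0; rewrite /I1 -ge0_integralZl//; last 2 first.
    + exact: mI.
    + by move=> eta _; exact: I0.
    apply: eq_integral => eta _; rewrite ge0_integralZl//.
    exact: (measurable_fun_pair1 eta mf).
  - move=> f mf f0 ndf; rewrite /I1 -monotone_convergence//; last 3 first.
    + by move=> n; exact: mI.
    + by move=> n eta _; exact: I0.
    + move=> eta _ a b ab; apply: ge0_le_integral => //.
      * exact: (measurable_fun_pair1 eta (mf a)).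
      * exact: (measurable_fun_pair1 eta (mf b)).
      * by move=> x _; exact: ndf.
    apply: eq_integral => eta _; rewrite monotone_convergence//.
    by move=> n; exact: (measurable_fun_pair1 eta (mf n)).
have mphi : measurable_fun setT (fun p : X * N => (p.1, cm_add_dirac p.2 p.1)).
  exact: measurable_fun_pair.
pose m2 := image_measure (density_measure (lzs \x P) mw w0) mphi.
have wfin p : w p \is a fin_num by rewrite ge0_fin_numE// (le_lt_trans (w1 p))// ltry.
have m2P f : measurable_fun setT f -> (forall p, 0 <= f p) -> \int[m2]_p f p =
    \int[lz]_x \int[P]_eta (f (x, cm_add_dirac eta x) * w (x, eta)).
  move=> mf f0; rewrite integral_image//.
  have mfp : measurable_fun setT (fun p : X * N => f (p.1, cm_add_dirac p.2 p.1)).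
    exact: (measurableT_comp mf mphi).
  rewrite integral_density//.
  apply: (@fubini_tonelli1 _ _ _ _ R lzs P (fun p => f (p.1, cm_add_dirac p.2 p.1) * w p)).
    exact: emeasurable_funM.
  by move=> p; apply: mule_ge0; [exact: f0|exact: w0].
have mE E : measurable E -> \int[m1]_p (\1_E p)%:E = m1 E.
  by move=> h; rewrite integral_indic// setIT.
have mE2 E : measurable E -> \int[m2]_p (\1_E p)%:E = m2 E.
  by move=> h; rewrite integral_indic// setIT.
have rect1 D A : measurable D -> measurable A ->
    m1 (D `*` A) = \int[P]_eta ((\1_A eta)%:E * eta D).
  move=> mD mA; rewrite -mE; last exact: measurableX.
  rewrite m1P; last 2 first.
  - by apply/measurable_EFinP; apply: measurable_indic; exact: measurableX.
  - by move=> p; rewrite lee_fin.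
  apply: eq_integral => eta _.
  transitivity (\int[cm eta]_x ((\1_A eta)%:E * (\1_D x)%:E)).
    by apply: eq_integral => x _; rewrite !indicE in_setX -EFinM mulrC -natrM mulnb.
  have mi : measurable_fun setT (fun x => (\1_D x)%:E : \bar R).
    by apply/measurable_EFinP; exact: measurable_indic.
  by rewrite ge0_integralZl// integral_indic// setIT.
have key E : measurable E -> m1 E = m2 E.
  (* An enumeration of the pairs (j, M); numbers that code no pair are sent to (0, 0). *)
  pose gs (n : nat) := let p := odflt (0%N, 0%N) (@choice.unpickle (nat * nat)%type n) in
    La p.1 `*` Ej p.1 p.2.
  apply: (@measure_unique _ _ _ test_rect gs measurable_test_rect test_rectI).
  - move=> n; rewrite /gs; set p := odflt _ _.
    rewrite -[Ej _ _]setTI.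
    exact: (test_rect_Ej _ (mLa _) (@subset_refl _ _) (cyl_setT La_b 0%N)).
  - rewrite -La_Ej_cover; apply/seteqP; split => [q [n _ qn]|q [p _ qp]].
      by exists (odflt (0%N, 0%N) (choice.unpickle n)).
    by exists (choice.pickle p) => //; rewrite /gs choice.pickleK.
  - move=> _ [D [A [j [k [b [-> mD Dj cA Ab]]]]]].
    have mA : measurable A by case: cA.
    rewrite rect1// (gnz_test mD Dj cA Ab HU HP) -mE2; last exact: measurableX.
    rewrite m2P; last 2 first.
    + by apply/measurable_EFinP; apply: measurable_indic; exact: measurableX.
    + by move=> p; rewrite lee_fin.
    pose h x := \int[P]_eta ((\1_A (cm_add_dirac eta x))%:E * w (x, eta)).
    have miA : measurable_fun setT (fun p : X * N => (\1_A (cm_add_dirac p.2 p.1))%:E : \bar R).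
      apply: (@measurableT_comp _ _ _ _ _ _ (fun eta : N => (\1_A eta)%:E : \bar R)) => //.
      by apply/measurable_EFinP; exact: measurable_indic.
    have miw : measurable_fun setT (fun p : X * N => (\1_A (cm_add_dirac p.2 p.1))%:E * w p).
      exact: emeasurable_funM.
    have iw0 (p : X * N) : 0 <= (\1_A (cm_add_dirac p.2 p.1))%:E * w p.
      by apply: mule_ge0; [rewrite lee_fin|exact: w0].
    have mh : measurable_fun setT h by exact: (mint P miw iw0).
    have h0 x : 0 <= h x by apply: integral_ge0 => eta _; exact: (iw0 (x, eta)).
    rewrite [LHS](integral_restr lz mD mh h0) integral_mkcond.
    apply: eq_integral => x _; rewrite patchE; case: ifPn => xD.
      by apply: eq_integral => eta _; rewrite !indicE in_setX xD.
    by rewrite [RHS]integral0_eq// => eta _; rewrite indicE in_setX (negbTE xD) mul0e.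
  - move=> n; rewrite /gs; set p := odflt _ _.
    rewrite rect1; [|exact: mLa|by case: (cyl_Ej p.1 p.2)].
    apply: (@le_lt_trans _ _ (\int[P]__ (p.2%:R%:E))).
      apply: ge0_le_integral => //.
      + apply: emeasurable_funM; last exact: measurable_eval.
        by apply/measurable_EFinP; apply: measurable_indic; case: (cyl_Ej p.1 p.2).
      + move=> eta _; rewrite indicE; case: (boolP (_ \in _)) => [/set_mem h|_].
          by rewrite mul1e.
        by rewrite mul0e lee_fin.
    by rewrite integral_probability_cst ltry.
move=> F mF F0; rewrite -m2P// -[LHS]/(I1 F) -m1P//.
by apply: eq_measure_integral => E mEE _; exact: key.
Qed.
End thermodynamic_limit.

Lemma nonnegative_gibbs : exists P : probability N R,
  forall F, measurable_fun setT F -> (forall p, 0 <= F p) ->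
  \int[P]_eta \int[cm eta]_x F (x, eta) =
  \int[lz]_x \int[P]_eta (F (x, cm_add_dirac eta x) * expeR (- Wpot v x eta)).
Proof.
have lzLa n : mrestr lz (mLa n) setT < +oo by exact: restr_fin.
have /choice[Pn PnP] := fun n =>
  finite_volume_gibbs La_b La_nd La_cover (finite_of (lzLa n)) mw w01 w_sym.
have Pn_gnz n := (PnP n).1.
have Pn_closed n := (PnP n).2.
have [U [UU HU]] := @ultraFilterLemma _ \oo _.
have [P HP] := limit_process (@Pn_sub Pn Pn_gnz).
exists P; exact: (gnz_limit Pn_gnz Pn_closed UU HU HP).
Qed.

End nonnegative_potential.

(** * Potentials nonnegative almost everywhere *)

Lemma signed_gibbs (v : X -> X -> \bar R) :
  measurable_fun setT (fun p : X * X => v p.1 p.2) ->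
  (forall x y, v x y = v y x) ->
  {ae (lz \x lz)%E, forall p : X * X, 0 <= v p.1 p.2} ->
  {ae lz, forall x, \int[lz]_y `|mayer v x y| < +oo} ->
  exists P : probability N R, forall F, measurable_fun setT F -> (forall p, 0 <= F p) ->
  \int[P]_eta \int[cm eta]_x F (x, eta) =
  \int[lz]_x \int[P]_eta (F (x, cm_add_dirac eta x) * expeR (- Wpot v x eta)).
Proof.
move=> mv v_sym [A [mA A0 vA]] v_int.
have mvx x : measurable_fun setT (v x) by exact: (measurable_fun_pair2 x mv).
pose v' x y := maxe (v x y) 0.
have v'0 x y : 0 <= v' x y by rewrite /v' le_max lexx orbT.
have v'E x y : 0 <= v x y -> v' x y = v x y by move=> ?; exact/max_idPl.
have mv' : measurable_fun setT (fun p : X * X => v' p.1 p.2) by exact: measurable_maxe.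
have mv'x x : measurable_fun setT (v' x) by exact: (measurable_fun_pair2 x mv').
have mexp (u : X -> X -> \bar R) x : measurable_fun setT (u x) ->
    measurable_fun setT (fun y => expeR (- u x y)).
  move=> mu; apply: (measurableT_comp (@measurable_expeR R)).
  by under eq_fun do rewrite -sub0e; exact: emeasurable_funB.
have mmayer (u : X -> X -> \bar R) x : measurable_fun setT (u x) ->
    measurable_fun setT (fun y => `|mayer u x y|).
  move=> mu; apply: (@measurableT_comp _ _ _ _ _ _ (@abse R)) => //.
  by apply: emeasurable_funB => //; exact: mexp.
(* Where [v] is negative, the Mayer function of its positive part is 0, so the integral can only
   decrease. *)
have v'_int : {ae lz, forall x, \int[lz]_y `|mayer v' x y| < +oo}.
  case: v_int => B [mB B0 vB]; exists B; split => //.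
  apply: subset_trans vB; apply: subsetC => x; apply: le_lt_trans.
  apply: ge0_le_integral => //.
  - exact: mmayer.
  - exact: mmayer.
  - move=> y _; have [vxy|vxy] := leP 0 (v x y); first by rewrite /mayer v'E.
    rewrite /mayer /v' (max_idPr (ltW vxy)) oppe0 expeR0 subee// abse0.
    exact: abse_ge0.
have [P PE] := nonnegative_gibbs mv' v'0 (fun x y => congr1 (maxe ^~ 0) (v_sym x y)) v'_int.
exists P => F mF F0; rewrite (PE F mF F0).
have mexpW (u : X -> X -> \bar R) : measurable_fun setT (fun p : X * X => u p.1 p.2) ->
    measurable_fun setT (fun p : X * N => expeR (- Wpot u p.1 p.2)).
  move=> mu; apply: (measurableT_comp (@measurable_expeR R)).
  by under eq_fun do rewrite -sub0e; apply: emeasurable_funB => //; exact: measurable_Wpot.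
have mphi : measurable_fun setT (fun p : X * N => (p.1, cm_add_dirac p.2 p.1)).
  exact: (measurable_fun_pair measurable_fst (@measurable_cm_add_dirac _ _ _ dist)).
have mH (u : X -> X -> \bar R) : measurable_fun setT (fun p : X * X => u p.1 p.2) ->
    measurable_fun setT (fun p : X * N =>
      F (p.1, cm_add_dirac p.2 p.1) * expeR (- Wpot u p.1 p.2)).
  move=> mu; apply: emeasurable_funM; last exact: mexpW.
  exact: (measurableT_comp mF mphi).
have H0 (u : X -> X -> \bar R) (p : X * N) :
    0 <= F (p.1, cm_add_dirac p.2 p.1) * expeR (- Wpot u p.1 p.2).
  by rewrite mule_ge0// expeR_ge0.
have mI (u : X -> X -> \bar R) : measurable_fun setT (fun p : X * X => u p.1 p.2) ->
    measurable_fun setT (fun x =>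
      \int[P]_eta (F (x, cm_add_dirac eta x) * expeR (- Wpot u x eta))).
  by move=> mu; exact: (@measurable_fun_fubini_tonelli_F _ _ _ _ R P _ (mH u mu) (H0 u)).
apply: ae_eq_integral => //; [exact: mI|exact: mI|].
have mxA x : measurable (xsection A x) by exact: measurable_xsection.
have mlA : measurable_fun setT (lzs \o xsection A) by exact: measurable_fun_xsection.
have [B [mB B0 lzB]] : {ae lz, forall x, lz (xsection A x) = 0}.
  have /ae_eq_integral_abs : measurable_fun setT (lzs \o xsection A) by [].
  move=> /(_ lz measurableT)[+ _].
  have -> : \int[lz]_x `|(lzs \o xsection A) x| = 0.
    by rewrite -[RHS]A0; apply: eq_integral => x _; rewrite gee0_abs.
  by move=> /(_ erefl); apply: filterS => x /(_ I).
exists B; split => //; apply: subset_trans lzB; apply: subsetC => x lzx0 _.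
apply: ae_eq_integral => //.
- exact: (measurable_fun_pair2 x (mH _ mv')).
- exact: (measurable_fun_pair2 x (mH _ mv)).
have mi : measurable_fun setT (fun p : X * N => (\1_(xsection A x) p.1)%:E : \bar R).
  by apply/measurable_EFinP; apply: measurableT_comp => //; exact: measurable_indic.
have i0 (p : X * N) : 0 <= (\1_(xsection A x) p.1)%:E :> \bar R by rewrite lee_fin.
(* GNZ for [v'], with weight at most 1, bounds the mean number of points in the section by its
   [lz]-measure, which is 0. *)
have Ex0 : \int[P]_eta `|eta (xsection A x)| = 0.
  apply/eqP; rewrite eq_le integral_ge0 ?andbT//.
  rewrite (_ : \int[P]_eta _ =
      \int[P]_eta \int[cm eta]_y (\1_(xsection A x) (y, eta).1)%:E); last first.
    by apply: eq_integral => eta _; rewrite gee0_abs// integral_indic// setIT.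
  rewrite (PE _ mi i0) -lzx0 -[X in lz X]setIT -integral_indic//.
  have miw : measurable_fun setT (fun p : X * N =>
      (\1_(xsection A x) p.1)%:E * expeR (- Wpot v' p.1 p.2)).
    by apply: emeasurable_funM => //; exact: mexpW.
  have miw0 (p : X * N) : 0 <= (\1_(xsection A x) p.1)%:E * expeR (- Wpot v' p.1 p.2).
    by rewrite mule_ge0// expeR_ge0.
  apply: ge0_le_integral => //.
  - by move=> y _; apply: integral_ge0 => eta _; exact: (miw0 (y, eta)).
  - exact: (@measurable_fun_fubini_tonelli_F _ _ _ _ R P _ miw miw0).
  - by apply/measurable_EFinP; exact: measurable_indic.
  move=> y _; rewrite -[leRHS](integral_probability_cst P).
  apply: ge0_le_integral => //.
  - by move=> eta _; exact: (miw0 (y, eta)).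
  - exact: (measurable_fun_pair2 y miw).
  - move=> eta _; rewrite -[leRHS]mule1; apply: lee_wpmul2l; first by rewrite lee_fin.
    by rewrite -expeR0 lee_expeR oppe_le0; apply: integral_ge0 => y' _; exact: v'0.
have meA : measurable_fun setT (fun eta : N => eta (xsection A x)) by exact: measurable_eval.
have /(ae_eq_integral_abs P measurableT meA) := Ex0.
apply: filterS => eta /(_ I) /= etax _; congr (_ * expeR (- _)).
apply: ae_eq_integral => //.
exists (xsection A x); split => // y /= /not_implyP[_ vxy].
by rewrite /xsection/=; apply/mem_set/vA => vxy0; apply: vxy; exact: v'E.
Qed.

End gibbs.

Lemma exhaustion_gibbs d (X : measurableType d) (R : realType) (dist : X -> X -> R)
    (La : nat -> set X) (lam : {measure set X -> \bar R}) (z : X -> R) (v : X -> X -> \bar R) :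
  (forall k, Xb dist (La k)) -> (forall i j, (i <= j)%N -> La i `<=` La j) ->
  \bigcup_k La k = setT -> La 0%N = set0 ->
  (forall B, Xb dist B -> exists k, B `<=` La k) ->
  measurable_fun setT z -> (forall x, (0 <= z x)%R) -> (forall k, lam_z lam z (La k) < +oo) ->
  measurable_fun setT (fun p : X * X => v p.1 p.2) -> (forall x y, v x y = v y x) ->
  {ae lam_z lam z \x lam_z lam z, forall p : X * X, 0 <= v p.1 p.2} ->
  {ae lam, forall x, \int[lam_z lam z]_y `|mayer v x y| < +oo} ->
  @Gibbs d X R dist lam z v !=set0.
Proof.
move=> La_b La_nd La_cover La0 La_bdd mz z0 Hz mv vsym Hi Hii.
have mz' : measurable_fun setT (fun x => (z x)%:E) by exact/measurable_EFinP.
have z0' x : 0 <= (z x)%:E by rewrite lee_fin.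
(* Its underlying set function is [lam_z lam z], so the hypotheses on the latter apply directly. *)
pose lz := density_measure lam mz' z0'.
have lz_fin k : lz (La k) < +oo by exact: Hz.
have Hii' : {ae lz, forall x, \int[lz]_y `|mayer v x y| < +oo}.
  case: Hii => B [mB B0 HB]; exists B; split => //.
  by apply: null_set_integral => //; exact: measurable_funTS.
have [P PE] := signed_gibbs La_b La_nd La_cover La0 La_bdd lz_fin mv vsym Hi Hii'.
exists P => F mF F0; rewrite (PE F mF F0).
pose h x := \int[P]_eta (F (x, cm_add_dirac eta x) * expeR (- Wpot v x eta)).
have mFW : measurable_fun setT (fun p : X * cmeasure dist =>
    F (p.1, cm_add_dirac p.2 p.1) * expeR (- Wpot v p.1 p.2)).
  apply: emeasurable_funM.
    exact: (measurableT_comp mF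
      (measurable_fun_pair measurable_fst (@measurable_cm_add_dirac _ _ _ dist))).
  apply: (measurableT_comp (@measurable_expeR R)).
  under eq_fun do rewrite -sub0e.
  apply: emeasurable_funB => //.
  exact: (@measurable_Wpot _ _ _ dist La La_b La_nd La_cover v mv).
have FW0 (p : X * cmeasure dist) :
    0 <= F (p.1, cm_add_dirac p.2 p.1) * expeR (- Wpot v p.1 p.2).
  by rewrite mule_ge0// expeR_ge0.
have mh : measurable_fun setT h.
  exact: (@measurable_fun_fubini_tonelli_F _ _ _ _ R P _ mFW FW0).
have h0 x : 0 <= h x by apply: integral_ge0 => eta _; exact: (FW0 (x, eta)).
have zfin x : (z x)%:E \is a fin_num by [].
exact: (integral_density lam mz' z0' zfin mh h0).
Qed.

Local Close Scope ereal_scope.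

Theorem mainTheorem13 (R : realType) (d : measure_display) (X : measurableType d)
  (dist : X -> X -> R)
  (Hmetric : is_metric dist) (Hcomplete : dist_complete dist)
  (Hsep : dist_separable dist)
  (Hborel : @measurable d X = <<s dist_open dist >>)
  (lam : {measure set X -> \bar R})
  (Hlam : forall B, Xb dist B -> (lam B < +oo)%E)
  (z : X -> R) (mz : measurable_fun [set: X] z) (z0 : forall x, 0 <= z x)
  (Hz : forall B, Xb dist B -> (lam_z lam z B < +oo)%E)
  (v : X -> X -> \bar R)
  (mv : measurable_fun [set: X * X] (fun p => v p.1 p.2))
  (vsym : forall x y, v x y = v y x)
  (vnotmoo : forall x y, v x y != -oo%E)
  (Hi : {ae (lam_z lam z \x lam_z lam z)%E, forall p : X * X, (0 <= v p.1 p.2)%E})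
  (Hii : {ae lam, forall x, (\int[lam_z lam z]_y `|mayer v x y| < +oo)%E}) :
  @Gibbs d X R dist lam z v !=set0.
Proof.
have [dist0 dist_sym dist_tri] := Hmetric.
pose o : X := point.
(* The strict inequality makes the balls open, hence Borel, and the ball of radius 0 empty, as the
   exhaustion requires. *)
pose La (k : nat) := [set x | (dist o x < k%:R)].
have dist_ge0 x y : (0 <= dist x y).
  have := dist_tri x y x; rewrite (dist_sym y x) (dist0 x x).2// => h.
  lra.
have La_b k : Xb dist (La k).
  split.
    rewrite Hborel; apply: sub_sigma_algebra => x /= xk.
    exists (k%:R - dist o x); first by rewrite subr_gt0.
    by move=> y xy; rewrite /La/=; apply: le_lt_trans (dist_tri o x y) _; rewrite -ltrBrDl.
  exists (k%:R + k%:R) => x y /ltW xk /ltW yk.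
  by apply: le_trans (dist_tri x o y) _; rewrite (dist_sym x o); exact: lerD.
have La_nd i j : (i <= j)%N -> La i `<=` La j.
  by move=> ij x /lt_le_trans; apply; rewrite ler_nat.
have La_cover : \bigcup_k La k = setT.
  apply/seteqP; split => // x _; exists (Num.truncn (dist o x)).+1 => //.
  exact: truncnS_gt.
have La0 : La 0%N = set0.
  by apply/seteqP; split => // x; rewrite /La/= ltNge dist_ge0.
have La_bdd B : Xb dist B -> exists k, B `<=` La k.
  move=> [_ [r rB]]; have [->|/set0P[x Bx]] := eqVneq B set0.
    by exists 0%N; exact: sub0set.
  exists (Num.truncn (dist o x + r)).+1 => y By; rewrite /La/=.
  apply: le_lt_trans (dist_tri o x y) _.
  by apply: le_lt_trans (truncnS_gt _); rewrite lerD2l; exact: rB.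
exact: (exhaustion_gibbs La_b La_nd La_cover La0 La_bdd mz z0
  (fun k => Hz _ (La_b k)) mv vsym Hi Hii).
Qed.
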